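(* Let $H$ be a Hilbert module over a $C^*$-algebra. For each idempotent $Q\in\mathcal{L}(H)$, with matched projection $m(Q)$, we have $$\|m(Q)-Q\|=\frac{1}{2}\left[\|Q\|-1+\sqrt{\|Q\|^2-1}\right].$$
   Context: $\mathcal{L}(H)$ is the $C^*$-algebra of adjointable operators on the Hilbert $C^*$-module $H$, and $I$ is the identity operator on $H$. $\mathcal{R}(\cdot)$ and $\mathcal{N}(\cdot)$ denote range and null space. An idempotent is $Q\in\mathcal{L}(H)$ with $Q^2=Q$; a projection is a self-adjoint idempotent. $P_{\mathcal{R}(Q)}$ is the projection of $H$ onto the (orthogonally complemented) range of $Q$. Definition of the matched projection $m(Q)$ of an idempotent $Q\in\mathcal{L}(H)$: if $Q$ is a projection, $m(Q)=Q$. Otherwise, $H=\mathcal{R}(Q)\dotplus\mathcal{N}(Q^* )$ is an orthogonal decomposition; let $U:H\to\mathcal{R}(Q)\oplus\mathcal{N}(Q^* )$ be the unitary $Uh=\binom{P_{\mathcal{R}(Q)}h}{(I-P_{\mathcal{R}(Q)})h}$, let $I_1$ be the identity on $\mathcal{R}(Q)$, let $A=(Q-P_{\mathcal{R}(Q)})|_{\mathcal{N}(Q^* )}:\mathcal{N}(Q^* )\to\mathcal{R}(Q)$ and $B=(AA^*+I_1)^{1/2}$, and set $$m(Q)=U^*\cdot\frac12\begin{pmatrix}(B+I_1)B^{-1} & B^{-1}A\\ A^*B^{-1} & A^*[B(B+I_1)]^{-1}A\end{pmatrix}\cdot U .$$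
   Formalization: The idempotent Q is assumed to be non-zero; for Q = 0 the left side is 0 while the right side contains the square root of −1, so the printed formula fails there. *)

(* Defs.v *)
From HB Require Import structures.
From mathcomp Require Import all_boot all_order all_algebra.
From mathcomp Require Import complex.
From mathcomp Require Import boolp classical_sets functions reals.
From mathcomp Require Import topology normedtype.
Import Order.TTheory GRing.Theory Num.Theory numFieldNormedType.Exports.

Set Implicit Arguments.
Unset Strict Implicit.
Unset Printing Implicit Defensive.

Local Open Scope classical_set_scope.
Local Open Scope ring_scope.

(* The algebra is not assumed to be unital, so it cannot be built on the      *)
(* (unital) ring structures of the library.                                   *)
HB.mixin Record isCstarAlgebra (R : realType) A
    of CompleteNormedModule R[i] A := {
  cmul : A -> A -> A;
  cstar : A -> A;
  cmulA : associative cmul;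
  cmulDl : left_distributive cmul +%R;
  cmulDr : right_distributive cmul +%R;
  cscalerAl : forall (k : R[i]) a b, k *: cmul a b = cmul (k *: a) b;
  cscalerAr : forall (k : R[i]) a b, k *: cmul a b = cmul a (k *: b);
  cnormM_le : forall a b, `|cmul a b| <= `|a| * `|b|;
  cstarK : involutive cstar;
  cstarD : {morph cstar : a b / a + b};
  cstarZ : forall (k : R[i]) a, cstar (k *: a) = k^* *: cstar a;
  cstarM : forall a b, cstar (cmul a b) = cmul (cstar b) (cstar a);
  cnorm_starM : forall a, `|cmul (cstar a) a| = `|a| ^+ 2
}.

#[short(type="cstarAlgType")]
HB.structure Definition CstarAlgebra (R : realType) :=
  {A of CompleteNormedModule R[i] A & isCstarAlgebra R A}.

Definition cpositive (R : realType) (A : cstarAlgType R) (a : A) : Prop :=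
  exists b : A, a = cmul (cstar b) b.

(* Right A-modules with an A-valued hermitian form (conjugate linear on the   *)
(* left). Positivity is split off because adjoints and direct sums can be     *)
(* defined without it, while positivity of the form on a direct sum requires  *)
(* the nontrivial fact that sums of positive elements are positive.           *)
HB.mixin Record isHermModule (R : realType) (A : cstarAlgType R) E
    of GRing.Lmodule R[i] E := {
  ract : E -> A -> E;
  ip : E -> E -> A;
  ractDl : forall x y a, ract (x + y) a = ract x a + ract y a;
  ractDr : forall x a b, ract x (a + b) = ract x a + ract x b;
  ractM : forall x a b, ract x (cmul a b) = ract (ract x a) b;
  ractZl : forall (k : R[i]) x a, k *: ract x a = ract (k *: x) a;
  ractZr : forall (k : R[i]) x a, k *: ract x a = ract x (k *: a);
  ipDr : forall x y z, ip x (y + z) = ip x y + ip x z;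
  ipZr : forall (k : R[i]) x y, ip x (k *: y) = k *: ip x y;
  ip_ract : forall x y a, ip x (ract y a) = cmul (ip x y) a;
  ip_star : forall x y, cstar (ip x y) = ip y x
}.

#[short(type="hermModType")]
HB.structure Definition HermModule (R : realType) (A : cstarAlgType R) :=
  {E of GRing.Lmodule R[i] E & isHermModule R A E}.

HB.mixin Record HermModule_isInnerProduct (R : realType) (A : cstarAlgType R) E
    of HermModule R A E := {
  ip_ge0 : forall x : E, cpositive (ip x x : A);
  ip_eq0 : forall x : E, (ip x x : A) = 0 -> x = 0
}.

#[short(type="innerProductModType")]
HB.structure Definition InnerProductModule (R : realType)
    (A : cstarAlgType R) :=
  {E of HermModule R A E & HermModule_isInnerProduct R A E}.

HB.mixin Record InnerProduct_isHilbert (R : realType) (A : cstarAlgType R) H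
    of InnerProductModule R A H & CompleteNormedModule R[i] H := {
  hnormE : forall x : H, `|x| ^+ 2 = `|ip x x : A|
}.

#[short(type="hilbertModType")]
HB.structure Definition HilbertModule (R : realType) (A : cstarAlgType R) :=
  {H of InnerProductModule R A H & CompleteNormedModule R[i] H
      & InnerProduct_isHilbert R A H}.

Section Basics.
Variables (R : realType) (A : cstarAlgType R).

Lemma cstarN (a : A) : cstar (- a) = - cstar a.
Proof. by rewrite -scaleN1r cstarZ rmorphN rmorph1 scaleN1r. Qed.

Lemma cmulr0 (a : A) : cmul a 0 = 0.
Proof. by apply: (addrI (cmul a 0)); rewrite -cmulDr !addr0. Qed.

Section Herm.
Variable E : hermModType A.
Implicit Types x y z : E.

Lemma ipDl x y z : ip (x + y) z = ip x z + ip y z :> A.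
Proof. by rewrite -ip_star ipDr cstarD !ip_star. Qed.

Lemma ipZl (k : R[i]) x y : ip (k *: x) y = k^* *: ip x y :> A.
Proof. by rewrite -ip_star ipZr cstarZ ip_star. Qed.

Lemma ip_ractl x y (a : A) : ip (ract x a) y = cmul (cstar a) (ip x y).
Proof. by rewrite -ip_star ip_ract cstarM ip_star. Qed.

Lemma ipBl x y z : ip (x - y) z = ip x z - ip y z :> A.
Proof. by rewrite -scaleN1r ipDl ipZl rmorphN rmorph1 scaleN1r. Qed.

Lemma ip0l z : ip 0 z = 0 :> A.
Proof. by rewrite -(subrr 0) ipBl subrr. Qed.

Lemma ip0r z : ip z 0 = 0 :> A.
Proof. by rewrite -(scale0r 0) ipZr scale0r. Qed.
End Herm.

Section Pair.
Variables E F : hermModType A.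

Definition pair_ract (u : E * F) (a : A) : E * F := (ract u.1 a, ract u.2 a).
Definition pair_ip (u v : E * F) : A := ip u.1 v.1 + ip u.2 v.2.

Let pair_ractDl u v a :
  pair_ract (u + v) a = pair_ract u a + pair_ract v a.
Proof. by rewrite /pair_ract !ractDl. Qed.
Let pair_ractDr u a b : pair_ract u (a + b) = pair_ract u a + pair_ract u b.
Proof. by rewrite /pair_ract !ractDr. Qed.
Let pair_ractM u a b : pair_ract u (cmul a b) = pair_ract (pair_ract u a) b.
Proof. by rewrite /pair_ract !ractM. Qed.
Let pair_ractZl (k : R[i]) u a : k *: pair_ract u a = pair_ract (k *: u) a.
Proof. by rewrite /pair_ract -!ractZl. Qed.
Let pair_ractZr (k : R[i]) u a : k *: pair_ract u a = pair_ract u (k *: a).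
Proof. by rewrite /pair_ract -!ractZr. Qed.
Let pair_ipDr u v w : pair_ip u (v + w) = pair_ip u v + pair_ip u w.
Proof. by rewrite /pair_ip !ipDr addrACA. Qed.
Let pair_ipZr (k : R[i]) u v : pair_ip u (k *: v) = k *: pair_ip u v.
Proof. by rewrite /pair_ip !ipZr scalerDr. Qed.
Let pair_ip_ract u v a : pair_ip u (pair_ract v a) = cmul (pair_ip u v) a.
Proof. by rewrite /pair_ip !ip_ract cmulDl. Qed.
Let pair_ip_star u v : cstar (pair_ip u v) = pair_ip v u.
Proof. by rewrite /pair_ip cstarD !ip_star. Qed.

HB.instance Definition _ := isHermModule.Build R A (E * F)%type
  pair_ractDl pair_ractDr pair_ractM pair_ractZl pair_ractZr
  pair_ipDr pair_ipZr pair_ip_ract pair_ip_star.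
End Pair.
End Basics.

Section Adjointable.
Variables (R : realType) (A : cstarAlgType R).

Definition is_adjoint (E F : hermModType A) (T : E -> F) (S : F -> E) : Prop :=
  forall x y, ip (T x) y = ip x (S y) :> A.

Definition adjointable (E F : hermModType A) : {pred (E -> F)} :=
  [pred T | `[< exists S, is_adjoint T S >]].

Section Closed.
Variables E F : hermModType A.

Lemma adjointable_submod : submod_closed (@adjointable E F).
Proof.
split=> [|k T1 T2]; rewrite !unfold_in.
  by apply: asboolT; exists (fun=> 0) => x y; rewrite ip0l ip0r.
move=> /asboolW[S1 h1] /asboolW[S2 h2]; apply: asboolT.
exists (fun y => k^* *: S1 y + S2 y) => x y.
by rewrite ipDl ipZl h1 h2 ipDr ipZr.
Qed.
HB.instance Definition _ :=
  GRing.isSubmodClosed.Build R[i] (E -> F) (@adjointable E F)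
    adjointable_submod.

Record adjop := Adjop { adjop_val :> E -> F; _ : adjop_val \in @adjointable E F }.
HB.instance Definition _ := [isSub for adjop_val].
HB.instance Definition _ := [Choice of adjop by <:].
HB.instance Definition _ := [SubChoice_isSubLmodule of adjop by <:].
End Closed.

Local Notation "''L' ( E , F )" := (adjop E F) (at level 8).

Definition mkadj (E F : hermModType A) (T : E -> F) (S : F -> E)
    (h : is_adjoint T S) : 'L(E, F) :=
  Adjop (asboolT (ex_intro (is_adjoint T) S h) : T \in @adjointable E F).

Lemma adj_subproof (E F : hermModType A) (T : 'L(E, F)) :
  exists S : 'L(F, E), is_adjoint T S.
Proof.
case: T => T /= /asboolW[S h].
suff h' : is_adjoint S T by exists (mkadj h').
by move=> y x; rewrite -ip_star -h ip_star.
Qed.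

Definition adj (E F : hermModType A) (T : 'L(E, F)) : 'L(F, E) :=
  projT1 (cid (adj_subproof T)).

Lemma adjP (E F : hermModType A) (T : 'L(E, F)) : is_adjoint T (adj T).
Proof. exact: projT2 (cid (adj_subproof T)). Qed.

Lemma adjP' (E F : hermModType A) (T : 'L(E, F)) : is_adjoint (adj T) T.
Proof. by move=> x y; rewrite -ip_star -adjP ip_star. Qed.

Lemma opid_subproof (E : hermModType A) : is_adjoint (@id E) id.
Proof. by []. Qed.
Definition opid (E : hermModType A) : 'L(E, E) := mkadj (@opid_subproof E).

Lemma opcomp_subproof (E F G : hermModType A) (S : 'L(F, G)) (T : 'L(E, F)) :
  is_adjoint (S \o T) (adj T \o adj S).
Proof. by move=> x y /=; rewrite !adjP. Qed.
Definition opcomp (E F G : hermModType A) (S : 'L(F, G)) (T : 'L(E, F)) :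
  'L(E, G) := mkadj (opcomp_subproof S T).

Lemma opblock_subproof (E F : hermModType A)
    (a : 'L(E, E)) (b : 'L(F, E)) (c : 'L(E, F)) (d : 'L(F, F)) :
  @is_adjoint (E * F)%type (E * F)%type
    (fun u => (a u.1 + b u.2, c u.1 + d u.2))
    (fun v => (adj a v.1 + adj c v.2, adj b v.1 + adj d v.2)).
Proof.
move=> [x1 x2] [y1 y2]; rewrite /ip /= /pair_ip /=.
by rewrite !ipDl !ipDr !adjP addrACA.
Qed.
Definition opblock (E F : hermModType A)
    (a : 'L(E, E)) (b : 'L(F, E)) (c : 'L(E, F)) (d : 'L(F, F)) :
  'L((E * F)%type, (E * F)%type) := mkadj (opblock_subproof a b c d).

Definition oppositive (E : hermModType A) (T : 'L(E, E)) : Prop :=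
  exists S : 'L(E, E), T = opcomp (adj S) S.

(* 0 if there is no positive square root. *)
Definition opsqrt (E : hermModType A) (T : 'L(E, E)) : 'L(E, E) :=
  xget 0 [set S | oppositive S /\ opcomp S S = T].

(* 0 if T is not invertible. *)
Definition opinv (E : hermModType A) (T : 'L(E, E)) : 'L(E, E) :=
  xget 0 [set S | opcomp S T = opid E /\ opcomp T S = opid E].

Definition is_idempotent (E : hermModType A) (Q : 'L(E, E)) : Prop :=
  opcomp Q Q = Q.

Definition is_projection (E : hermModType A) (P : 'L(E, E)) : Prop :=
  is_idempotent P /\ adj P = P.

End Adjointable.

Notation "''L' ( E , F )" := (adjop E F) (at level 8) : type_scope.
Notation "''L' ( E )" := (adjop E E) (at level 8) : type_scope.
Notation "T ^†" := (adj T) (at level 2, format "T ^†") : ring_scope.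
Notation "S ∘ T" := (opcomp S T) (at level 40, left associativity) : ring_scope.

Section Submodules.
Variables (R : realType) (A : cstarAlgType R) (E : innerProductModType A).

Record submodule := Submodule {
  submod_set : set E;
  submodP : submod_closed (mem submod_set);
  submod_ract : forall x (a : A), submod_set x -> submod_set (ract x a)
}.

Section SubmodType.
Variable V : submodule.

Definition submod_pred : {pred E} := mem (submod_set V).
HB.instance Definition _ :=
  GRing.isSubmodClosed.Build R[i] E submod_pred (submodP V).

Record submod_type := SubmodElt {
  submod_val :> E; _ : submod_val \in submod_pred }.
HB.instance Definition _ := [isSub for submod_val].
HB.instance Definition _ := [Choice of submod_type by <:].
HB.instance Definition _ := [SubChoice_isSubLmodule of submod_type by <:].

Lemma sub_ract_subproof (x : submod_type) (a : A) :
  ract (val x) a \in submod_pred.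
Proof. by have /set_mem xV := valP x; apply/mem_set/submod_ract. Qed.

Definition sub_ract (x : submod_type) (a : A) : submod_type :=
  SubmodElt (sub_ract_subproof x a).
Definition sub_ip (x y : submod_type) : A := ip (val x) (val y).

Let sub_ractDl x y a : sub_ract (x + y) a = sub_ract x a + sub_ract y a.
Proof. by apply: val_inj; rewrite /= ractDl. Qed.
Let sub_ractDr x a b : sub_ract x (a + b) = sub_ract x a + sub_ract x b.
Proof. by apply: val_inj; rewrite /= ractDr. Qed.
Let sub_ractM x a b : sub_ract x (cmul a b) = sub_ract (sub_ract x a) b.
Proof. by apply: val_inj; rewrite /= ractM. Qed.
Let sub_ractZl (k : R[i]) x a : k *: sub_ract x a = sub_ract (k *: x) a.
Proof. by apply: val_inj; rewrite /= ractZl. Qed.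
Let sub_ractZr (k : R[i]) x a : k *: sub_ract x a = sub_ract x (k *: a).
Proof. by apply: val_inj; rewrite /= ractZr. Qed.
Let sub_ipDr x y z : sub_ip x (y + z) = sub_ip x y + sub_ip x z.
Proof. by rewrite /sub_ip -ipDr. Qed.
Let sub_ipZr (k : R[i]) x y : sub_ip x (k *: y) = k *: sub_ip x y.
Proof. by rewrite /sub_ip -ipZr. Qed.
Let sub_ip_ract x y a : sub_ip x (sub_ract y a) = cmul (sub_ip x y) a.
Proof. by rewrite /sub_ip -ip_ract. Qed.
Let sub_ip_star x y : cstar (sub_ip x y) = sub_ip y x.
Proof. exact: ip_star. Qed.
HB.instance Definition _ := isHermModule.Build R A submod_type
  sub_ractDl sub_ractDr sub_ractM sub_ractZl sub_ractZr
  sub_ipDr sub_ipZr sub_ip_ract sub_ip_star.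

Let sub_ip_ge0 (x : submod_type) : cpositive (ip x x : A).
Proof. exact: ip_ge0. Qed.
Let sub_ip_eq0 (x : submod_type) : (ip x x : A) = 0 -> x = 0.
Proof. by move=> x0; apply/val_inj/ip_eq0. Qed.
HB.instance Definition _ := HermModule_isInnerProduct.Build R A submod_type
  sub_ip_ge0 sub_ip_eq0.

End SubmodType.
End Submodules.

Coercion submod_type : submodule >-> Sortclass.

Section RangeKernel.
Variables (R : realType) (A : cstarAlgType R) (E F : innerProductModType A).
Variable T : 'L(E, F).

Lemma ip_inj (x y : F) : (forall z, ip x z = ip y z :> A) -> x = y.
Proof.
by move=> h; apply/eqP; rewrite -subr_eq0; apply/eqP/ip_eq0; rewrite ipBl h subrr.
Qed.

Lemma adjop_linear : linear T.
Proof.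
by move=> k x y; apply: ip_inj => z; rewrite ipDl ipZl !adjP ipDl ipZl.
Qed.

Lemma adjop_ract (x : E) (a : A) : T (ract x a) = ract (T x) a.
Proof. by apply: ip_inj => z; rewrite ip_ractl !adjP ip_ractl. Qed.

Lemma adjop0 : T 0 = 0.
Proof. by apply: ip_inj => z; rewrite adjP !ip0l. Qed.

Lemma op_range_submod : submod_closed (mem (range T)).
Proof.
split; first by apply/mem_set; exists 0 => //; exact: adjop0.
move=> k _ _ /set_mem[x _ <-] /set_mem[y _ <-]; apply/mem_set.
by exists (k *: x + y) => //; exact: adjop_linear.
Qed.

Lemma op_range_ract (x : F) (a : A) : range T x -> range T (ract x a).
Proof. by case=> y _ <-; exists (ract y a) => //; exact: adjop_ract. Qed.

Definition op_range : submodule F := Submodule op_range_submod op_range_ract.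

Lemma op_ker_submod : submod_closed (mem [set x | T x = 0]).
Proof.
split; first by apply/mem_set; exact: adjop0.
move=> k x y /set_mem /= x0 /set_mem /= y0; apply/mem_set => /=.
by rewrite adjop_linear x0 y0 scaler0 addr0.
Qed.

Lemma op_ker_ract (x : E) (a : A) :
  [set x | T x = 0] x -> [set x | T x = 0] (ract x a).
Proof.
move=> /= x0; rewrite adjop_ract x0; apply: ip_inj => z.
by rewrite ip_ractl !ip0l cmulr0.
Qed.

Definition op_ker : submodule E := Submodule op_ker_submod op_ker_ract.

End RangeKernel.

Section MatchedProjection.
Variables (R : realType) (A : cstarAlgType R) (H : hilbertModType A).

Definition opnorm (T : 'L(H)) : R :=
  sup [set complex.Re `|T x| | x in [set x : H | `|x| <= 1]].

(* The unique projection with range V, if V is orthogonally complemented. *)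
Definition proj_onto (V : submodule H) : 'L(H) :=
  xget 0 [set P | is_projection P /\ range P = submod_set V].

(* T|_V as an operator V -> W; meaningful if T maps V into W. *)
Definition op_restr (V W : submodule H) (T : 'L(H)) : 'L(V, W) :=
  xget 0 [set S : 'L(V, W) | forall x : V, val (S x) = T (val x)].

(* h |-> (P h, (I - P) h), for P a projection with range V and kernel W. *)
Definition op_split (V W : submodule H) (P : 'L(H)) : 'L(H, (V * W)%type) :=
  xget 0 [set U : 'L(H, (V * W)%type) |
    forall h, val (U h).1 = P h /\ val (U h).2 = (opid H - P) h].

Definition matched_proj (Q : 'L(H)) : 'L(H) :=
  if `[< is_projection Q >] then Q else
  let P := proj_onto (op_range Q) in
  let I1 := opid (op_range Q) in
  let U := op_split (op_range Q) (op_ker Q^†) P in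
  let T := op_restr (op_ker Q^†) (op_range Q) (Q - P) in
  let B := opsqrt (T ∘ T^† + I1) in
  U^† ∘ (2^-1 *: opblock ((B + I1) ∘ opinv B)  (opinv B ∘ T)
                         (T^† ∘ opinv B)       (T^† ∘ opinv (B ∘ (B + I1)) ∘ T))
      ∘ U.

End MatchedProjection.

(* Main.v *)
(* Put P for the projection onto the range of Q, N = Q - P, K = Q - Q^†, and    *)
(* let b be the positive square root of 1 - K^2 = 1 + N N^† + N^† N, which      *)
(* commutes with P, Q and Q^†. Then W = b^-1 (1 - Q - Q^†) is a selfadjoint     *)
(* unitary that anticommutes with K, and                                        *)
(*                     m(Q) - Q = ((b - 1) W - K) / 2.                          *)
(* Hence W (m(Q) - Q) = (g - J) / 2 with g = b - 1 >= 0 and J = W K selfadjoint *)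
(* commuting with g, J^2 = g^2 + 2 g and W J W = - J. The triangle inequality   *)
(* gives |m(Q) - Q| <= (|g| + sqrt (|g|^2 + 2 |g|)) / 2. Conversely, if         *)
(* e = |m(Q) - Q| then e - (g - J) / 2 and e - (g + J) / 2 are commuting        *)
(* positive elements, and so is their product e^2 - (e + 1/2) g; this is the    *)
(* reverse inequality. Finally |Q| = |b| = 1 + |g|.                             *)
(* Since A is an arbitrary C*-algebra, the Cauchy-Schwarz inequality in H needs *)
(* the positivity of the elements x^* x, and the boundedness of adjointable     *)
(* operators needs a uniform boundedness argument.                             *)

From Stdlib Require Ncring Ncring_tac.
From HB Require Import structures.
Require Import Defs.
From mathcomp Require Import all_boot all_order all_algebra.
From mathcomp Require Import complex.
From mathcomp Require Import boolp classical_sets functions reals.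
From mathcomp Require Import topology normedtype sequences.
From mathcomp Require Import ring lra.
Import Order.TTheory GRing.Theory Num.Theory numFieldNormedType.Exports.
Set Implicit Arguments.
Unset Strict Implicit.
Unset Printing Implicit Defensive.
Local Open Scope classical_set_scope.
Local Open Scope ring_scope.
Local Open Scope complex_scope.

(** * Norms and completeness *)

Section RealNorm.
Variable R : realType.

(** The computation takes place in the unital C*-algebra ['L(H)]. Let p be the range projection of q
    = Q, n = q - p, and b the positive root of 1 + n n^⋆ + n^⋆ n. Since b commutes with p and q, the
    block matrix of m(q) becomes the expression [matched_expr] in b, p, n ([matched_projE]). A
    selfadjoint unitary w turns m(q) - q into (g - J) / 2, where g = b - 1 is positive, J is
    selfadjoint and commutes with g, J^2 = g^2 + 2 g, and conjugation by w changes the sign of J. So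
    a spectral value t of g contributes (t + sqrt (t^2 + 2 t)) / 2, which increases with t; the norm
    is its value at t = |g|. [norm_matched_diff] obtains this without spectra, from the triangle
    inequality and the positivity of a product of commuting positive elements. [norm_idempotent] and
    [norm_matched_root] give |q| = |b| = 1 + |g|.

    That ['L(H)] is a C*-algebra rests on the Cauchy-Schwarz inequality in H, which in turn needs
    positivity of x^⋆ x in A. The circle is broken by A as a module over itself: there the
    inequality is immediate, so ['L(A)] is a unital C*-algebra, [upos_starM] applies in it, and
    [cauchy_schwarz_hilbert] follows for every H. *)

Lemma le_mul_eps_eq0 (x c : R) : 0 <= x -> 0 <= c ->
  (forall e, 0 < e -> x <= c * e) -> x = 0.
Proof.
move=> x0 c0 h; apply/eqP; rewrite eq_le x0 andbT leNgt; apply/negP => xp.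
have c1 : 0 < c + 1 by rewrite ltr_wpDl.
set e := x / (c + 1) / 2.
have e0 : 0 < e by rewrite !divr_gt0.
have xe : x = 2 * (c + 1) * e by rewrite /e; field; rewrite gt_eqF.
by have := h _ e0; rewrite xe; nra.
Qed.

(** Over the scalars [R[i]] the norm is complex valued; nothing is lost by taking its real part
    ([rnormE]). *)
Definition rnorm (V : normedModType R[i]) (x : V) : R := complex.Re `|x|.

Lemma Re_normC (k : R) : complex.Re `|k%:C| = `|k|.
Proof. by rewrite normc_def /= expr0n addr0 sqrtr_sqr. Qed.

Lemma normcN1 : complex.Re `|-1 : R[i]| = 1.
Proof. by rewrite normrN1. Qed.

Section Basics.
Variable V : normedModType R[i].
Implicit Types x y : V.

Lemma rnormE x : `|x| = (rnorm x)%:C.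
Proof.
rewrite /rnorm; have := normr_ge0 x; case: (`|x|) => a b; rewrite lecE /=.
by case/andP => /eqP -> _.
Qed.

Lemma rnorm_ge0 x : 0 <= rnorm x.
Proof. by rewrite -lecR -rnormE normr_ge0. Qed.

Lemma rnorm0 : rnorm (0 : V) = 0.
Proof. by rewrite /rnorm normr0. Qed.

Lemma rnorm_eq0 x : rnorm x = 0 -> x = 0.
Proof. by move=> h; apply/eqP; rewrite -normr_eq0 rnormE h. Qed.

Lemma rnormD x y : rnorm (x + y) <= rnorm x + rnorm y.
Proof. by rewrite -lecR rmorphD /= -!rnormE ler_normD. Qed.

Lemma rnormZ (k : R[i]) x : rnorm (k *: x) = complex.Re `|k| * rnorm x.
Proof. by rewrite {1}/rnorm normrZ rnormE /= mulr0 subr0. Qed.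

Lemma rnormZr (k : R) x : rnorm (k%:C *: x) = `|k| * rnorm x.
Proof. by rewrite rnormZ Re_normC. Qed.

Lemma rnormN x : rnorm (- x) = rnorm x.
Proof. by rewrite /rnorm normrN. Qed.

Lemma rnorm_le_eq0 x c :
  0 <= c -> (forall e, 0 < e -> rnorm x <= c * e) -> x = 0.
Proof. by move=> c0 h; apply: rnorm_eq0; exact: le_mul_eps_eq0 (rnorm_ge0 x) c0 h. Qed.

End Basics.

(** Convergence is handled by majorants: the increments of a sequence are bounded by those of a
    bounded real sequence [t]. This supplies the limit [s] of [t]. *)
Lemma majorant_sup (t : nat -> R) (M : R) :
  (forall n, t n <= M) -> (forall n, t n <= t n.+1) ->
  exists s, [/\ s <= M, forall n, t n <= s
    & forall e, 0 < e -> exists n, forall m, (n <= m)%N -> s - t m < e].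
Proof.
move=> tM tS.
have hs : has_sup (range t).
  by split; [exists (t 0%N); exists 0%N | exists M => _ [n _ <-]].
exists (sup (range t)); split.
- by apply: ge_sup => [|_ [n _ <-]//]; exists (t 0%N); exists 0%N.
- by move=> n; apply: ub_le_sup; [exact: hs.2 | exists n].
move=> e e0; have [_ [n _ <-] h] := sup_adherent e0 hs.
exists n => m nm; rewrite ltrBlDl -ltrBlDr (lt_le_trans h)//.
by move/nondecreasing_seqP: tS; apply.
Qed.

Lemma increments_le (V : normedModType R[i]) (u : nat -> V) (t : nat -> R) :
  (forall n, rnorm (u n.+1 - u n) <= t n.+1 - t n) ->
  forall n m, (n <= m)%N -> rnorm (u m - u n) <= t m - t n.
Proof.
move=> h n m /subnK <-; elim: (m - n)%N => [|k ih].
  by rewrite add0n !subrr rnorm0.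
have -> : u (k.+1 + n)%N - u n = (u (k.+1 + n)%N - u (k + n)%N) + (u (k + n)%N - u n).
  by rewrite addrA subrK.
rewrite (le_trans (rnormD _ _))// (le_trans (lerD (h _) ih))//.
by rewrite addSn addrA subrK.
Qed.

(** The sequence is Cauchy because [t] is; the error bound is |u m - u n| <= t m - t n in the limit
    in m. *)
Lemma majorized_cvg (V : completeNormedModType R[i]) (u : nat -> V)
    (t : nat -> R) (s : R) :
  (forall n, rnorm (u n.+1 - u n) <= t n.+1 - t n) ->
  (forall e, 0 < e -> exists n, forall m, (n <= m)%N -> s - t m < e) ->
  (forall n, t n <= s) ->
  exists l, forall n, rnorm (l - u n) <= s - t n.
Proof.
move=> h ht ts; have uc := increments_le h.
have /cauchy_cvg : cauchy (u @ \oo).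
  apply: cauchy_exP => e e0.
  have e0' : 0 < complex.Re e by move: e0; rewrite ltcE => /andP[].
  have ee : e = (complex.Re e)%:C.
    by move: e0; rewrite ltcE /= => /andP[/eqP]; case: (e) => a b /= ->.
  have [n hn] := ht _ e0'; exists (u n); exists n => // m /= nm.
  rewrite -ball_normE /= rnormE ee ltcR -rnormN opprB (le_lt_trans (uc _ _ nm))//.
  by rewrite (le_lt_trans _ (hn n _))// lerB.
move=> /cvg_ex[l ul]; exists l => n.
apply/ler_addgt0Pr => e e0.
have e0' : 0 < e%:C by rewrite ltcR.
have /cvgrPdist_lt /(_ _ e0') [N _ hN] := ul.
have := hN (maxn N n) (leq_maxl _ _); rewrite /= rnormE ltcR => hl.
have -> : l - u n = (l - u (maxn N n)) + (u (maxn N n) - u n).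
  by rewrite addrA subrK.
rewrite (le_trans (rnormD _ _))// addrC lerD ?(ltW hl)//.
by rewrite (le_trans (uc _ _ (leq_maxr _ _)))// lerB.
Qed.

End RealNorm.

(** * Unital C*-algebras *)

(** The norm is real valued and completeness is expressed by majorants, so that an operator algebra
    can be an instance without being given a topology. *)
HB.mixin Record isUnitalCstar (R : realType) B
    of GRing.Algebra R[i] B := {
  ustar : B -> B;
  unorm : B -> R;
  ustarK : involutive ustar;
  ustarD : {morph ustar : a b / a + b};
  ustarZ : forall (k : R[i]) a, ustar (k *: a) = k^*%R *: ustar a;
  ustarM : forall a b, ustar (a * b) = ustar b * ustar a;
  unorm_eq0 : forall a, unorm a = 0 -> a = 0;
  unormD : forall a b, unorm (a + b) <= unorm a + unorm b;
  unormZ : forall (k : R[i]) a, unorm (k *: a) = complex.Re `|k| * unorm a;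
  unormM : forall a b, unorm (a * b) <= unorm a * unorm b;
  unorm_starM : forall a, unorm (ustar a * a) = unorm a ^+ 2;
  ucomplete : forall (u : nat -> B) (t : nat -> R) (s : R),
    (forall n, unorm (u n.+1 - u n) <= t n.+1 - t n) ->
    (forall e, 0 < e -> exists n, forall m, (n <= m)%N -> s - t m < e) ->
    (forall n, t n <= s) ->
    exists l, forall n, unorm (l - u n) <= s - t n
}.

#[short(type="ucstarType")]
HB.structure Definition UnitalCstar (R : realType) :=
  {B of GRing.Algebra R[i] B & isUnitalCstar R B}.

(** * Automatic proof of identities in noncommutative rings *)

Section NoncommutativeRing.
Variable B : nzRingType.

Instance nzRing_ring_ops : @Ncring.Ring_ops B 0 1 (fun x y => x + y)
  (fun x y => x * y) (fun x y => x - y) (fun x => - x) eq := {}.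

Instance nzRing_ring : Ncring.Ring (Ro := nzRing_ring_ops).
Proof.
split; try exact _; cbv [Algebra_syntax.equality Algebra_syntax.addition
  Algebra_syntax.multiplication Algebra_syntax.opposite Algebra_syntax.zero
  Algebra_syntax.one Algebra_syntax.subtraction Ncring.eq_notation
  Ncring.add_notation Ncring.mul_notation Ncring.opp_notation
  Ncring.zero_notation Ncring.one_notation Ncring.sub_notation].
- exact: add0r.
- exact: addrC.
- exact: addrA.
- exact: mul1r.
- exact: mulr1.
- exact: mulrA.
- exact: mulrDl.
- by move=> *; exact: mulrDr.
- by [].
- exact: subrr.
Qed.
End NoncommutativeRing.

#[global] Existing Instance nzRing_ring_ops.
#[global] Existing Instance nzRing_ring.

Ltac ncring := intros; Ncring_tac.non_commutative_ring.

Section UnitalCstarTheory.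
Variables (R : realType) (B : ucstarType R).
Implicit Types (a b s t x y z h : B) (k r : R).

Local Notation "a ^⋆" := (ustar a) (at level 2, format "a ^⋆").
Local Notation nrm := (@unorm R B).
Local Notation "r %:S" := (r%:C *: (1 : B)) (at level 2, format "r %:S").

Lemma unormZr r a : nrm (r%:C *: a) = `|r| * nrm a.
Proof. by rewrite unormZ Re_normC. Qed.

Lemma unorm0 : nrm 0 = 0.
Proof. by rewrite -(scale0r (0 : B)) unormZ normr0 mul0r. Qed.

Lemma unormN a : nrm (- a) = nrm a.
Proof. by rewrite -scaleN1r unormZ normcN1 mul1r. Qed.

Lemma unorm_ge0 a : 0 <= nrm a.
Proof. by have := unormD a (- a); rewrite subrr unorm0 unormN; lra. Qed.

Lemma unormB a b : nrm (a - b) = nrm (b - a).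
Proof. by rewrite -unormN opprB. Qed.

Lemma unormBD a b c : nrm (a - c) <= nrm (a - b) + nrm (b - c).
Proof. by rewrite (le_trans _ (unormD _ _))// addrA subrK. Qed.

Lemma unorm_le_eq0 x k :
  0 <= k -> (forall e, 0 < e -> nrm x <= k * e) -> x = 0.
Proof. by move=> k0 h; apply: unorm_eq0; exact: le_mul_eps_eq0 (unorm_ge0 x) k0 h. Qed.

Lemma conjCr r : (r%:C)^*%R = r%:C.
Proof. by rewrite conj_Creal//= complex_real. Qed.

Lemma ustarZr r a : (r%:C *: a)^⋆ = r%:C *: a^⋆.
Proof. by rewrite ustarZ conjCr. Qed.

Lemma ustar0 : (0 : B)^⋆ = 0.
Proof. by apply: (addrI (0 : B)^⋆); rewrite -ustarD !addr0. Qed.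

Lemma ustarN a : (- a)^⋆ = - a^⋆.
Proof. by rewrite -scaleN1r ustarZ rmorphN rmorph1 scaleN1r. Qed.

Lemma ustarB a b : (a - b)^⋆ = a^⋆ - b^⋆.
Proof. by rewrite ustarD ustarN. Qed.

Lemma ustar1 : (1 : B)^⋆ = 1.
Proof. by rewrite -[LHS]mul1r -{1}[1]ustarK -ustarM mul1r ustarK. Qed.

Lemma ustarS r : (r%:S)^⋆ = r%:S.
Proof. by rewrite ustarZr ustar1. Qed.

Lemma unorm_star a : nrm a^⋆ = nrm a.
Proof.
suff h b : nrm b <= nrm b^⋆.
  by apply/eqP; rewrite eq_le h -{2}[a]ustarK h.
have [->|b0] := eqVneq (nrm b) 0; first exact: unorm_ge0.
have bp : 0 < nrm b by rewrite lt_def b0 unorm_ge0.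
by rewrite -(ler_pM2r bp) -expr2 -unorm_starM unormM.
Qed.

Lemma unorm_sq a : a^⋆ = a -> nrm (a * a) = nrm a ^+ 2.
Proof. by move=> sa; rewrite -{1}sa unorm_starM. Qed.

Lemma unorm_neq0 a : a != 0 -> 0 < nrm a.
Proof.
move=> a0; rewrite lt_def unorm_ge0 andbT; apply: contraNneq a0 => h.
by apply/eqP/unorm_eq0.
Qed.

Lemma unorm1 : nrm 1 = 1.
Proof.
have /unorm_neq0 n1 := oner_neq0 B; have := unorm_sq ustar1.
by rewrite mulr1 => h; apply: (mulfI (lt0r_neq0 n1)); rewrite mulr1 -expr2 -h.
Qed.

Lemma unormS r : 0 <= r -> nrm r%:S = r.
Proof. by move=> r0; rewrite unormZr ger0_norm// unorm1 mulr1. Qed.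

Lemma commZ x (k : R[i]) y : GRing.comm x y -> GRing.comm x (k *: y).
Proof. by move=> c; rewrite /GRing.comm -scalerAl -scalerAr c. Qed.

Lemma commS x r : GRing.comm x r%:S.
Proof. by apply: commZ; exact: commr1. Qed.

Lemma mulSl r x : r%:S * x = r%:C *: x.
Proof. by rewrite -scalerAl mul1r. Qed.

Lemma mulSr r x : x * r%:S = r%:C *: x.
Proof. by rewrite -scalerAr mulr1. Qed.

Lemma SD r k : (r + k)%:S = r%:S + k%:S.
Proof. by rewrite rmorphD scalerDl. Qed.

Lemma SB r k : (r - k)%:S = r%:S - k%:S.
Proof. by rewrite rmorphB scalerBl. Qed.

Lemma ulimit (u : nat -> B) (t : nat -> R) (M : R) :
  (forall n, nrm (u n.+1 - u n) <= t n.+1 - t n) -> (forall n, t n <= M) ->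
  exists l, (forall n, nrm (l - u n) <= M - t n) /\
    (forall e, 0 < e -> exists n, forall m, (n <= m)%N -> nrm (l - u m) < e).
Proof.
move=> h tM.
have tS n : t n <= t n.+1 by rewrite -subr_ge0 (le_trans (unorm_ge0 _) (h n)).
have [s [sM ts hs]] := majorant_sup tM tS.
have [l hl] := ucomplete _ _ _ h hs ts; exists l; split=> [n|e e0].
  by rewrite (le_trans (hl n))// lerB.
by have [n hn] := hs _ e0; exists n => m nm; rewrite (le_lt_trans (hl m)) ?hn.
Qed.

(** Closed conditions, such as commuting with x or being selfadjoint, pass to the limit as zeros of
    a Lipschitz map. *)
Lemma ulimit_closed (u : nat -> B) l (F : B -> B) k :
  (forall e, 0 < e -> exists n, forall m, (n <= m)%N -> nrm (l - u m) < e) ->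
  0 <= k -> (forall x y, nrm (F x - F y) <= k * nrm (x - y)) ->
  (forall n, F (u n) = 0) -> F l = 0.
Proof.
move=> ul k0 hF Fu; apply: (unorm_le_eq0 k0) => e e0.
have [n hn] := ul _ e0; have := hF l (u n); rewrite Fu subr0 => /le_trans; apply.
by rewrite ler_wpM2l// ltW// hn.
Qed.

Lemma ulimit_comm (u : nat -> B) l x :
  (forall e, 0 < e -> exists n, forall m, (n <= m)%N -> nrm (l - u m) < e) ->
  (forall n, GRing.comm x (u n)) -> GRing.comm x l.
Proof.
move=> ul h; apply/eqP; rewrite -subr_eq0; apply/eqP.
apply: (ulimit_closed (F := fun y => x * y - y * x) ul (k := 2 * nrm x)).
- by rewrite mulr_ge0// unorm_ge0.
- move=> y z.
  have -> : x * y - y * x - (x * z - z * x) = x * (y - z) - (y - z) * x.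
    by ncring.
  rewrite (le_trans (unormD _ _))// unormN.
  by have := unormM x (y - z); have := unormM (y - z) x; lra.
- by move=> n; rewrite h subrr.
Qed.

Lemma neumann z r : 0 <= r < 1 -> nrm z <= r ->
  exists y, y * (1 - z) = 1 /\ (1 - z) * y = 1.
Proof.
move=> /andP[r0 r1] zr.
(* The partial sums of the geometric series of z, majorized by those of r. *)
pose u := fix u n := if n is m.+1 then 1 + z * u m else 0.
pose t n := (1 - r ^+ n) / (1 - r).
have r1' : 0 < 1 - r by rewrite subr_gt0.
have ut n : nrm (u n.+1 - u n) <= t n.+1 - t n.
  have -> : t n.+1 - t n = r ^+ n.
    by rewrite /t exprS; field; rewrite gt_eqF.
  elim: n => [|n ih]; first by rewrite /= mulr0 addr0 subr0 expr0 unorm1.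
  have -> : u n.+2 - u n.+1 = z * (u n.+1 - u n).
    by rewrite mulrBr /= opprD addrACA subrr add0r.
  rewrite exprS (le_trans (unormM _ _))// ler_pM ?unorm_ge0//.
have tM n : t n <= (1 - r)^-1.
  by rewrite /t ler_pdivrMr// mulVf ?gt_eqF// gerBl exprn_ge0.
have [y [_ hy]] := ulimit ut tM.
(* The limit commutes with z, so it is a two-sided inverse. *)
have uc n : GRing.comm z (u n).
  elim: n => [|n ih]; first exact: commr0.
  by apply: commrD; [exact: commr1 | exact: commrM].
have yc := ulimit_comm hy uc.
have yE : y - (1 + z * y) = 0.
  apply: (@unorm_le_eq0 _ (1 + nrm z)); first by rewrite addr_ge0// unorm_ge0.
  move=> e e0; have [n hn] := hy _ e0.
  rewrite (le_trans (unormBD _ (u n.+1) _))//.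
  have -> : u n.+1 - (1 + z * y) = z * (u n - y).
    by rewrite mulrBr /= opprD addrACA subrr add0r.
  have := ltW (hn n.+1 (leqnSn _)); have := ltW (hn n (leqnn _)).
  have := unormM z (u n - y); rewrite (unormB (u n)); have := unorm_ge0 z.
  by nra.
have yE' : y - z * y = 1.
  by move/eqP: yE; rewrite subr_eq0 => /eqP {1}->; rewrite addrK.
by exists y; rewrite mulrBl mulrBr mulr1 mul1r -yc yE'.
Qed.

(* [1 - s] is the limit of the iterates of [y |-> (z + y ^ 2) / 2] from [0],   *)
(* which are majorized by the same iterates of real numbers for [z = 1].       *)
Lemma sqrt_one_minus z : z^⋆ = z -> nrm z <= 1 ->
  exists s, [/\ s^⋆ = s, nrm (1 - s) <= 1, s * s = 1 - z
    & forall x, GRing.comm x z -> GRing.comm x s].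
Proof.
move=> sz z1.
pose hf := (2^-1 : R)%:C.
pose u := fix u n := if n is m.+1 then hf *: (z + u m * u m) else 0.
pose t := fix t n : R := if n is m.+1 then 2^-1 * (1 + t m ^+ 2) else 0.
have hfn a : nrm (hf *: a) = 2^-1 * nrm a by rewrite unormZr ger0_norm ?invr_ge0.
have t01 n : 0 <= t n <= 1.
  by elim: n => [|n /andP[h0 h1]] /=; [rewrite lexx ler01 | nra].
have un n : nrm (u n) <= t n.
  elim: n => [|n ih]; first by rewrite unorm0.
  rewrite hfn ler_pM2l ?invr_gt0// (le_trans (unormD _ _))// lerD//.
  by rewrite (le_trans (unormM _ _))// -expr2 lerXn2r// nnegrE ?unorm_ge0//;
    case/andP: (t01 n).
(* This form needs no commutation and gives the bound (t n.+1 + t n) (t n.+1 - t n), which is the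
   same recursion for [t]. *)
have sqB a b : a * a - b * b = a * (a - b) + (a - b) * b.
  by rewrite mulrBr mulrBl addrA subrK.
have uS n : u n.+2 - u n.+1 = hf *: (u n.+1 * u n.+1 - u n * u n).
  by rewrite [u n.+2]/= {2}[u n.+1]/= -scalerBr opprD addrACA subrr add0r.
have ut n : nrm (u n.+1 - u n) <= t n.+1 - t n.
  elim: n => [|n ih].
    by rewrite /= mulr0 addr0 subr0 expr0n /= addr0 hfn mulr1 subr0; nra.
  rewrite uS hfn.
  have -> : t n.+2 - t n.+1 = 2^-1 * ((t n.+1 + t n) * (t n.+1 - t n)).
    have tS m : t m.+1 = 2^-1 * (1 + t m ^+ 2) by [].
    by move: (tS n.+1) (tS n) => ->; move: (t n.+1) (t n) => t1 t0; lra.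
  rewrite ler_pM2l ?invr_gt0// sqB (le_trans (unormD _ _))//.
  have h1 := unormM (u n.+1) (u n.+1 - u n).
  have h2 := unormM (u n.+1 - u n) (u n).
  have := un n; have := un n.+1; have := unorm_ge0 (u n); have := unorm_ge0 (u n.+1).
  have := unorm_ge0 (u n.+1 - u n); move: ih h1 h2.
  move: (nrm (u n.+1 - u n)) (nrm (u n)) (nrm (u n.+1)).
  move: (nrm (u n.+1 * _)) (nrm (_ * u n)) (t n) (t n.+1).
  by move=> p q t0 t1 d n0 n1; nra.
have tM n : t n <= 1 by case/andP: (t01 n).
have [y [y1 hy]] := ulimit ut tM.
have yc x : GRing.comm x z -> GRing.comm x y.
  move=> xz; apply: (ulimit_comm hy); elim=> [|n ih]; first exact: commr0.
  by apply: commZ; apply: commrD => //; exact: commrM.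
have ys : y^⋆ = y.
  apply/eqP; rewrite -subr_eq0; apply/eqP.
  apply: (ulimit_closed (F := fun y => y^⋆ - y) hy (k := 2)) => //.
    move=> a b; have -> : a^⋆ - a - (b^⋆ - b) = (a - b)^⋆ - (a - b).
      by rewrite ustarB; ncring.
    by rewrite (le_trans (unormD _ _))// unormN unorm_star mulr2n mulrDl mul1r.
  elim=> [|n ih]; first by rewrite ustar0 subrr.
  move/eqP: ih; rewrite subr_eq0 => /eqP ih.
  by rewrite /= ustarZr ustarD ustarM sz ih subrr.
have yn : nrm y <= 1 by have := y1 0%N; rewrite /= !subr0.
have yE : y - hf *: (z + y * y) = 0.
  apply: (@unorm_le_eq0 _ 2) => // e e0; have [n hn] := hy _ e0.
  rewrite (le_trans (unormBD _ (u n.+1) _))//.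
  have -> : u n.+1 - hf *: (z + y * y) = hf *: (u n * u n - y * y).
    by rewrite [u n.+1]/= -scalerBr opprD addrACA subrr add0r.
  rewrite hfn sqB.
  have := unormD (u n * (u n - y)) ((u n - y) * y).
  have := unormM (u n) (u n - y); have := unormM (u n - y) y.
  have := ltW (hn n.+1 (leqnSn _)); have := ltW (hn n (leqnn _)).
  rewrite (unormB (u n)).
  have := un n; have := tM n; have := unorm_ge0 (u n); have := unorm_ge0 y.
  have := unorm_ge0 (y - u n); move: yn.
  move: (nrm (u n)) (nrm (y - u n)) (nrm y) (t n) (nrm (y - u n.+1)) => p q r' t0 m.
  by nra.
(* The fixed point equation, equivalent to (1 - y)^2 = 1 - z. *)
have yE2 : y + y = z + y * y.
  have hfE : hf + hf = 1.
    by rewrite -rmorphD -[RHS](rmorph1 (real_complex R)); congr (_%:C); lra.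
  by move/eqP: yE; rewrite subr_eq0 => /eqP {1 2}->; rewrite -scalerDl hfE scale1r.
exists (1 - y); split.
- by rewrite ustarB ustar1 ys.
- by rewrite opprB addrC subrK.
- have -> : (1 - y) * (1 - y) = 1 - (y + y) + y * y by ncring.
  by rewrite yE2; ncring.
- by move=> x xz; apply: commrB; [exact: commr1 | exact: yc].
Qed.

End UnitalCstarTheory.

(** * Positive elements *)

Section Positive.
Variables (R : realType) (B : ucstarType R).
Implicit Types (a b s t x y z h : B) (k r : R).

Local Notation "a ^⋆" := (ustar a) (at level 2, format "a ^⋆").
Local Notation nrm := (@unorm R B).
Local Notation "r %:S" := (r%:C *: (1 : B)) (at level 2, format "r %:S").

(* The norm characterization of positivity, which is stable under sums by the  *)
(* triangle inequality; that it contains every [x^⋆ x] is [upos_starM].        *)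
Definition upos a : Prop := a^⋆ = a /\ exists2 k, 0 <= k & nrm (k%:S - a) <= k.

Lemma upos_sa a : upos a -> a^⋆ = a. Proof. by case. Qed.

(** Rescaling of [sqrt_one_minus]: the root of k - z is sqrt k times that of 1 - z / k. The norm
    bound says that the root satisfies [upos]. *)
Lemma sqrt_shift z k : z^⋆ = z -> 0 <= k -> nrm z <= k ->
  exists s, [/\ s^⋆ = s, nrm ((Num.sqrt k)%:S - s) <= Num.sqrt k,
    s * s = k%:S - z & forall x, GRing.comm x z -> GRing.comm x s].
Proof.
move=> sz k0 zk; have [k00|kn0] := eqVneq k 0.
  have z0 : z = 0.
    by apply: unorm_eq0; apply/eqP; rewrite eq_le unorm_ge0 -k00 zk.
  exists 0; rewrite k00 z0 sqrtr0 scale0r; split => //.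
  - by rewrite ustar0.
  - by rewrite subr0 unorm0.
  - by rewrite mulr0 subr0.
have kp : 0 < k by rewrite lt_def kn0.
have sk0 : 0 <= Num.sqrt k := sqrtr_ge0 k.
pose w := (k^-1)%:C *: z.
have kw : k%:C *: w = z.
  by rewrite scalerA -rmorphM mulfV// rmorph1 scale1r.
have w1 : nrm w <= 1.
  by rewrite unormZr ger0_norm ?invr_ge0// ler_pdivrMl ?mulr1.
have sw : w^⋆ = w by rewrite ustarZr sz.
have [s [ss s1 s2 sc]] := sqrt_one_minus sw w1.
exists ((Num.sqrt k)%:C *: s); split.
- by rewrite ustarZr ss.
- by rewrite -scalerBr unormZr ger0_norm// ler_piMr.
- rewrite -scalerAl -scalerAr scalerA -rmorphM -expr2 sqr_sqrtr// s2.
  by rewrite scalerBr kw.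
- by move=> x xz; apply: commZ; apply: sc; exact: commZ.
Qed.

Lemma upos_sqrt a : upos a ->
  exists s, [/\ upos s, s * s = a & forall x, GRing.comm x a -> GRing.comm x s].
Proof.
move=> [sa [k k0 ka]].
have sz : (k%:S - a)^⋆ = k%:S - a by rewrite ustarB ustarS sa.
have [s [ss s1 s2 sc]] := sqrt_shift sz k0 ka.
exists s; split.
- by split=> //; exists (Num.sqrt k) => //; exact: sqrtr_ge0.
- by rewrite s2; ncring.
- by move=> x xa; apply: sc; apply: commrB => //; exact: commS.
Qed.

Let I : R[i] := 'i.
Let conjI : (I^*)%R = - I.
Proof. by apply/eqP; rewrite eq_complex /= eqxx oppr0 eqxx. Qed.
Let sqrI : I * I = -1. Proof. by rewrite -expr2 sqr_i. Qed.

(* [s + i t] is normal and [s] is its real part. *)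
Lemma sa_sq_le s t : s^⋆ = s -> t^⋆ = t -> GRing.comm s t ->
  nrm s ^+ 2 <= nrm (s * s + t * t).
Proof.
move=> ss st c; pose u := s + I *: t.
have su : u^⋆ = s - I *: t by rewrite ustarD ustarZ ss st conjI scaleNr.
have uu : u^⋆ * u = s * s + t * t.
  rewrite su mulrDr !mulrBl -!scalerAl -!scalerAr c scalerA sqrI scaleN1r.
  by ncring.
have h : (1 + 1)%:C *: s = u + u^⋆.
  by rewrite su /u rmorphD scalerDl rmorph1 scale1r; ncring.
have : nrm s <= nrm u.
  have := unormD u u^⋆; rewrite -h unormZr unorm_star ger0_norm ?addr_ge0//.
  by lra.
rewrite -uu unorm_starM; have := unorm_ge0 s; have := unorm_ge0 u.
by move: (nrm s) (nrm u) => p q; nra.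
Qed.

(** With k = |h^2| and s a root of k - h^2 commuting with h, [sa_sq_le] gives |k - h^2| = |s|^2 <=
    |s^2 + h^2| = k. *)
Lemma upos_sq h : h^⋆ = h -> upos (h * h).
Proof.
move=> sh; have shh : (h * h)^⋆ = h * h by rewrite ustarM sh.
split=> //; exists (nrm (h * h)); first exact: unorm_ge0.
have [s [ss _ s2 sc]] := sqrt_shift shh (unorm_ge0 _) (lexx _).
have c : GRing.comm s h.
  by apply/commr_sym/sc; apply: commrM; exact: commr_refl.
rewrite -s2 unorm_sq// (le_trans (sa_sq_le ss sh c))// s2 subrK.
by rewrite unormS// unorm_ge0.
Qed.

Lemma uposD a b : upos a -> upos b -> upos (a + b).
Proof.
move=> [sa [k k0 ka]] [sb [r r0 rb]]; split; first by rewrite ustarD sa sb.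
exists (k + r); first exact: addr_ge0.
rewrite SD; have -> : k%:S + r%:S - (a + b) = (k%:S - a) + (r%:S - b) by ncring.
by rewrite (le_trans (unormD _ _))// lerD.
Qed.

Lemma uposZ k a : 0 <= k -> upos a -> upos (k%:C *: a).
Proof.
move=> k0 [sa [r r0 ra]]; split; first by rewrite ustarZr sa.
exists (k * r); first exact: mulr_ge0.
by rewrite rmorphM -scalerA -scalerBr unormZr ger0_norm// ler_wpM2l.
Qed.

Lemma upos1 : upos 1.
Proof. by rewrite -[1]mulr1; apply: upos_sq; exact: ustar1. Qed.

(** The roots s of a and t of - a commute, and s^2 + t^2 = 0 forces s = 0 by [sa_sq_le]. *)
Lemma upos_antisym a : upos a -> upos (- a) -> a = 0.
Proof.
move=> pa pna; have [s [ps s2 sc]] := upos_sqrt pa.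
have [t [pt t2 tc]] := upos_sqrt pna.
have c : GRing.comm s t.
  by apply: tc; apply: commrN; apply/commr_sym/sc; exact: commr_refl.
have := sa_sq_le (upos_sa ps) (upos_sa pt) c; rewrite s2 t2 subrr unorm0.
rewrite real_exprn_even_le0 ?num_real//= => /eqP /unorm_eq0 s0.
by rewrite -s2 s0 mulr0.
Qed.

(** Writing a = s^2 and k - a = t^2 with commuting roots, |a| = |s|^2 <= |s^2 + t^2| = k. *)
Lemma upos_norm_le a k : 0 <= k -> upos a -> upos (k%:S - a) -> nrm a <= k.
Proof.
move=> k0 pa pb; have [s [ps s2 sc]] := upos_sqrt pa.
have [t [pt t2 tc]] := upos_sqrt pb.
have c : GRing.comm s t.
  apply: tc; apply: commrB; first exact: commS.
  by apply/commr_sym/sc; exact: commr_refl.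
have := sa_sq_le (upos_sa ps) (upos_sa pt) c; rewrite s2 t2.
have -> : a + (k%:S - a) = k%:S by ncring.
by rewrite unormS// -s2 unorm_sq// upos_sa.
Qed.

Lemma norm_le_upos a k : a^⋆ = a -> nrm a <= k -> upos (k%:S - a).
Proof.
move=> sa ak; split; first by rewrite ustarB ustarS sa.
exists k; first exact: le_trans (unorm_ge0 _) ak.
by have -> : k%:S - (k%:S - a) = a by ncring.
Qed.

Lemma upos_mul a b : upos a -> upos b -> GRing.comm a b -> upos (a * b).
Proof.
move=> pa pb c; have [s [ps s2 sc]] := upos_sqrt pa.
have [t [pt t2 tc]] := upos_sqrt pb.
have st : GRing.comm s t by apply: tc; apply/commr_sym/sc/commr_sym.
have -> : a * b = (s * t) * (s * t).
  by rewrite -s2 -t2 -!mulrA; congr (_ * _); rewrite mulrA [in LHS]st mulrA.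
by apply: upos_sq; rewrite ustarM (upos_sa ps) (upos_sa pt).
Qed.

(** Up to a factor 2 this is the sum of the squares of the selfadjoint elements x + x^⋆ and i (x -
    x^⋆). *)
Lemma upos_starD x : upos (x^⋆ * x + x * x^⋆).
Proof.
pose s := x + x^⋆; pose t := I *: (x - x^⋆).
have ss : s^⋆ = s by rewrite ustarD ustarK addrC.
have st : t^⋆ = t.
  by rewrite ustarZ conjI ustarB ustarK /t scaleNr -scalerN opprB.
have tt : t * t = - ((x - x^⋆) * (x - x^⋆)).
  by rewrite -scalerAl -scalerAr scalerA sqrI scaleN1r.
have h : (1 + 1)%:C *: (x^⋆ * x + x * x^⋆) = s * s + t * t.
  by rewrite rmorphD scalerDl rmorph1 scale1r tt /s; ncring.
have -> : x^⋆ * x + x * x^⋆ = (2^-1)%:C *: (s * s + t * t).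
  rewrite -h scalerA -rmorphM.
  have -> : 2^-1 * (1 + 1) = 1 :> R by lra.
  by rewrite rmorph1 scale1r.
by apply: uposZ; [rewrite invr_ge0 | apply: uposD; apply: upos_sq].
Qed.

Lemma sa_sq_eq0 s : s^⋆ = s -> s * s = 0 -> s = 0.
Proof.
move=> ss s0; apply: unorm_eq0; apply/eqP.
by rewrite -sqrf_eq0 -unorm_sq// s0 unorm0.
Qed.

(* Fukamiya, Kelley and Vaught. With [r] the modulus of [h := x^⋆ x], the      *)
(* element [v := r - h] satisfies [v h = - v r], so [y := x v] has             *)
(* [y^⋆ y = - w ^ 2] with [w] selfadjoint; then [z := y w] gives               *)
(* [z^⋆ z + z z^⋆ = - (w ^ 4 + (y y^⋆) ^ 2)], which is also positive.          *)
Lemma upos_starM x : upos (x^⋆ * x).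
Proof.
set h := x^⋆ * x.
have sh : h^⋆ = h by rewrite ustarM ustarK.
have [r [pr r2 rc]] := upos_sqrt (upos_sq sh).
have hr : GRing.comm h r.
  by apply: rc; apply: commrM; exact: commr_refl.
have [t [pt t2 tc]] := upos_sqrt pr.
have ht : GRing.comm h t by exact: tc.
have rt : GRing.comm r t by apply: tc; exact: commr_refl.
pose v := r - h.
have sv : v^⋆ = v by rewrite ustarB (upos_sa pr) sh.
have tv : GRing.comm t v by apply: commrB; exact: commr_sym.
have vh : v * h = - (v * r).
  have : v * (r + h) = 0.
    rewrite mulrBl !mulrDr r2 hr; ncring.
  by move=> /eqP; rewrite mulrDr addrC addr_eq0 => /eqP.
pose w := t * v; pose y := x * v; pose z := y * w.
have sw : w^⋆ = w by rewrite ustarM sv (upos_sa pt) -tv.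
have yy : y^⋆ * y = - (w * w).
  have -> : y^⋆ * y = v * h * v.
    by rewrite ustarM sv /y /h !mulrA.
  rewrite vh mulNr; congr (- _).
  by rewrite -t2 /w {1}tv !mulrA -!(mulrA v).
have zz : z^⋆ * z = - ((w * w) * (w * w)).
  have -> : z^⋆ * z = w * (y^⋆ * y) * w by rewrite ustarM sw /z !mulrA.
  by rewrite yy; ncring.
pose q := y * y^⋆.
have sq : q^⋆ = q by rewrite ustarM ustarK.
have zz' : z * z^⋆ = - (q * q).
  have -> : z * z^⋆ = y * (w * w) * y^⋆ by rewrite ustarM sw /z !mulrA.
  have -> : w * w = - (y^⋆ * y) by rewrite yy opprK.
  by rewrite /q; ncring.
have pw : upos ((w * w) * (w * w)) by apply: upos_sq; rewrite ustarM sw.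
have pq : upos (q * q) by exact: upos_sq.
have w0 : (w * w) * (w * w) = 0.
  have /upos_antisym : upos ((w * w) * (w * w) + q * q) by exact: uposD.
  have -> : - (w * w * (w * w) + q * q) = z^⋆ * z + z * z^⋆.
    by rewrite zz zz'; ncring.
  move=> /(_ (upos_starD _)) /eqP; rewrite addr_eq0 => /eqP e.
  by apply: upos_antisym => //; rewrite e opprK.
have {}w0 : w = 0.
  by apply: sa_sq_eq0 => //; apply: sa_sq_eq0 => //; rewrite ustarM sw.
(* Now w = t v = 0 kills v r v = v t (t v), and v^3 = 2 v r v; hence v = 0 and h = r. *)
have vv : v * v = v * r + v * r by rewrite {2}/v mulrBr vh opprK.
have v0 : v = 0.
  have vrv : v * r * v = 0.
    by rewrite -t2 -!mulrA -[t * v]/w w0 !mulr0.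
  have v3 : v * v * v = 0 by rewrite vv mulrDl vrv addr0.
  apply: sa_sq_eq0 => //; apply: sa_sq_eq0; first by rewrite ustarM sv.
  by rewrite mulrA v3 mul0r.
by move/eqP: v0; rewrite subr_eq0 => /eqP <-.
Qed.

Lemma upos_conj a x : upos a -> upos (x^⋆ * a * x).
Proof.
move=> /upos_sqrt[s [ps s2 _]].
have -> : x^⋆ * a * x = (s * x)^⋆ * (s * x).
  by rewrite ustarM (upos_sa ps) -s2 !mulrA.
exact: upos_starM.
Qed.

(* If [r] is the square root of [a ^ 2] and [d := a - r], then [d a d] and     *)
(* [d r d] are positive and their sum is [0], hence both vanish and            *)
(* [d ^ 3 = 0]. *)
Lemma upos_sqrt_uniq a b : upos a -> upos b -> a * a = b * b -> a = b.
Proof.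
move=> pa pb ab.
have [r [pr r2 rc]] := upos_sqrt (upos_sq (upos_sa pa)).
suff h c : upos c -> c * c = a * a -> c = r.
  by rewrite (h a)// (h b).
move=> pc ca.
have cr : GRing.comm c r.
  by apply: rc; rewrite -ca; apply: commrM; exact: commr_refl.
pose d := c - r.
have sd : d^⋆ = d by rewrite ustarB (upos_sa pc) (upos_sa pr).
have pcd : upos (d * c * d) by rewrite -{1}sd; exact: upos_conj.
have prd : upos (d * r * d) by rewrite -{1}sd; exact: upos_conj.
have dcr : d * (c + r) = 0 by rewrite /d mulrBl !mulrDr ca r2 cr; ncring.
have e : d * c * d + d * r * d = 0 by rewrite -mulrDl -mulrDr dcr mul0r.
have c0 : d * c * d = 0.
  apply: upos_antisym => //; move/eqP: e; rewrite addr_eq0 => /eqP ->.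
  by rewrite opprK.
have r0 : d * r * d = 0 by rewrite c0 add0r in e.
have d3 : d * d * d = 0.
  have -> : d * d * d = d * (c - r) * d by [].
  by rewrite [d * (c - r)]mulrBr mulrBl c0 r0 subrr.
have d0 : d = 0.
  apply: sa_sq_eq0 => //; apply: sa_sq_eq0; first by rewrite ustarM sd.
  by rewrite mulrA d3 mul0r.
by move/eqP: d0; rewrite subr_eq0 => /eqP.
Qed.

(** If |r - a| <= r, then k + a = (k + r) (1 - z) with z = (r - a) / (k + r) and |z| <= r / (k + r)
    < 1, so the Neumann series applies. *)
Lemma upos_inv_shift a k : upos a -> 0 < k ->
  exists y, y * (k%:S + a) = 1 /\ (k%:S + a) * y = 1.
Proof.
move=> [sa [r r0 ra]] k0.
have kr : 0 < k + r by rewrite ltr_pwDl.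
pose c := (k + r)^-1; pose z := c%:C *: (r%:S - a).
have c0 : 0 < c by rewrite invr_gt0.
have zr : nrm z <= c * r by rewrite unormZr gtr0_norm// ler_pM2l.
have cr : 0 <= c * r < 1.
  by rewrite mulr_ge0 ?(ltW c0)//= /c mulrC ltr_pdivrMr// mul1r ltrDr.
have [y [y1 y2]] := neumann cr zr.
have e : k%:S + a = (k + r)%:C *: (1 - z).
  rewrite scalerBr scalerA -rmorphM mulfV ?gt_eqF// rmorph1 scale1r SD.
  by ncring.
exists (c%:C *: y); rewrite e -!scalerAl -!scalerAr !scalerA y1 y2 -!rmorphM.
by rewrite mulVf ?mulfV ?gt_eqF// rmorph1 scale1r.
Qed.

Lemma comm_inv x a y : y * a = 1 -> a * y = 1 -> GRing.comm x a -> GRing.comm x y.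
Proof.
move=> ya ay xa; rewrite /GRing.comm -[RHS]mulr1 -ay.
by rewrite -[in RHS]mulrA (mulrA x) xa !mulrA ya mul1r.
Qed.

Lemma upos_inv a y : upos a -> y * a = 1 -> a * y = 1 -> upos y.
Proof.
move=> pa ya ay; have [s [ps s2 sc]] := upos_sqrt pa.
have sy : y^⋆ = y.
  have h : a * y^⋆ = 1 by rewrite -{1}(upos_sa pa) -ustarM ya ustar1.
  by rewrite -[LHS]mul1r -ya -mulrA h mulr1.
have c : GRing.comm s y by apply: (comm_inv ya ay); apply/commr_sym/sc.
have -> : y = (s * y) * (s * y).
  by rewrite {1}c -mulrA (mulrA s s) s2 ay mulr1.
by apply: upos_sq; rewrite ustarM sy (upos_sa ps) c.
Qed.

End Positive.

(** * Idempotents in a unital C*-algebra *)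

Section Idempotent.
Variables (R : realType) (B : ucstarType R).
Implicit Types (a x y z : B) (k r : R).

Local Notation "a ^⋆" := (ustar a) (at level 2, format "a ^⋆").
Local Notation nrm := (@unorm R B).
Local Notation "r %:S" := (r%:C *: (1 : B)) (at level 2, format "r %:S").

(** The first hypothesis is s^2 <= (2 x - t)^2 in disguise. The branch 2 x <= t - s is compatible
    with t <= s and 0 <= x only when x = 0, and then t = s = 0. *)
Lemma root_bound (s x t : R) : (x + 2^-1) * t <= x ^+ 2 -> 0 <= t -> 0 <= x ->
  0 <= s -> s ^+ 2 = t ^+ 2 + 2 * t -> 2^-1 * (t + s) <= x.
Proof.
move=> h t0 x0 s0 st; rewrite leNgt; apply/negP => lt.
have st' : t <= s by rewrite -(ler_pXn2r (n := 2)) ?nnegrE// st; lra.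
have k : 0 <= (2 * x - t - s) * (2 * x - t + s) by nra.
have k' : 2 * x - t + s <= 0 by nra.
have x00 : x = 0 by lra.
by move: h; rewrite x00 expr0n; nra.
Qed.

Lemma S1 : 1%:S = 1. Proof. by rewrite rmorph1 scale1r. Qed.

Lemma half_double x : (2^-1 : R)%:C *: (x + x) = x.
Proof.
rewrite scalerDr -scalerDl -rmorphD.
have -> : 2^-1 + 2^-1 = 1 :> R by lra.
by rewrite rmorph1 scale1r.
Qed.

Lemma comm_star x y : y^⋆ = y -> GRing.comm y x -> GRing.comm y x^⋆.
Proof. by move=> sy c; rewrite /GRing.comm -{1}sy -ustarM -c ustarM sy. Qed.

(** The element e = 1 - (q - q^⋆)^2 is invertible and commutes with q, both products being q q^⋆ q.
    This makes p = q q^⋆ e^-1 the range projection; b is the root of e, c = b e^-1 its inverse, and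
    d the inverse of b + 1. *)
Lemma idempotent_split (q : B) : q * q = q ->
  exists p b c d : B,
  [/\ [/\ p * p = p, p^⋆ = p, p * q = q & q * p = p],
      [/\ upos b, b * b = 1 - (q - q^⋆) * (q - q^⋆), GRing.comm b q
        & GRing.comm b p],
      c * b = 1 /\ b * c = 1 & d * (b + 1) = 1 /\ (b + 1) * d = 1].
Proof.
move=> qq.
have qq' : q^⋆ * q^⋆ = q^⋆ by rewrite -ustarM qq.
set f := q - q^⋆; have sf : f^⋆ = - f by rewrite ustarB ustarK opprB.
have pa : upos (- (f * f)) by rewrite -mulNr -sf; exact: upos_starM.
set e := 1 - f * f.
have pe : upos e by apply: uposD pa; exact: upos1.
have eE : e = 1 - q - q^⋆ + q * q^⋆ + q^⋆ * q.
  have -> : e = 1 - q * q - q^⋆ * q^⋆ + q * q^⋆ + q^⋆ * q.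
    by rewrite /e /f; ncring.
  by rewrite qq qq'.
have qe : q * e = q * q^⋆ * q.
  have -> : q * e = q - q * q + (q * q) * q^⋆ - q * q^⋆ + q * q^⋆ * q.
    by rewrite eE; ncring.
  by rewrite qq; ncring.
have eq : e * q = q * q^⋆ * q.
  have -> : e * q = q - q * q - q^⋆ * q + q * q^⋆ * q + q^⋆ * (q * q).
    by rewrite eE; ncring.
  by rewrite qq; ncring.
have cqe : GRing.comm q e by rewrite /GRing.comm qe.
have [y []] := upos_inv_shift pa ltr01; rewrite S1 -/e => ye ey.
have py := upos_inv pe ye ey.
have cqy : GRing.comm q y := comm_inv ye ey cqe.
have cqy' : GRing.comm y q^⋆.
  by apply: comm_star; [exact: upos_sa | exact: commr_sym].
have [b [pb bb bc]] := upos_sqrt pe.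
have cbq : GRing.comm b q by apply/commr_sym/bc.
have cby : GRing.comm b y.
  by apply: (comm_inv ye ey); apply/commr_sym/bc; exact: commr_refl.
have [d []] := upos_inv_shift pb ltr01; rewrite S1 addrC => db bd.
exists (q * q^⋆ * y), b, (b * y), d; split=> //; split=> //.
- have -> : q * q^⋆ * y * (q * q^⋆ * y) = q * q^⋆ * (q * q^⋆) * y * y.
    have : GRing.comm y (q * q^⋆) by apply: commrM => //; exact: commr_sym.
    by move=> h; rewrite mulrA -(mulrA (q * _) y) h !mulrA.
  have ce : GRing.comm e (q * q^⋆).
    apply: commrM; first exact: commr_sym.
    by apply: comm_star; [exact: upos_sa | exact: commr_sym].
  have -> : q * q^⋆ * (q * q^⋆) = q * q^⋆ * e by rewrite -ce [in RHS]mulrA eq mulrA.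
  by rewrite -(mulrA _ e y) ey mulr1.
- by rewrite !ustarM ustarK (upos_sa py); apply: commrM => //; exact: commr_sym.
- by rewrite -mulrA -cqy mulrA -qe -mulrA ey mulr1.
- by rewrite !mulrA qq.
- apply: commrM => //; apply: commrM => //.
  by apply: comm_star => //; exact: upos_sa.
- by rewrite cby -mulrA bb.
- by rewrite mulrA bb.
Qed.

(** * The distance from an idempotent to its matched projection *)

Section MatchedNorm.
Variables q p b c d : B.
Hypotheses (pp : p * p = p) (sp : p^⋆ = p) (pq : p * q = q) (qp : q * p = p).
Hypotheses (pb : upos b) (bb : b * b = 1 - (q - q^⋆) * (q - q^⋆)).
Hypotheses (cbq : GRing.comm b q) (cbp : GRing.comm b p).
Hypotheses (cb : c * b = 1) (bc : b * c = 1).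
Hypotheses (db : d * (b + 1) = 1) (bd : (b + 1) * d = 1).

Let n := q - p.
Let f := 1 - q - q^⋆.
Let K := q - q^⋆.
Let w := c * f.
Let g := b - 1.

Let qq : q * q = q. Proof. by rewrite -{2}pq mulrA qp pq. Qed.
Let qq' : q^⋆ * q^⋆ = q^⋆. Proof. by rewrite -ustarM qq. Qed.
Let sb : b^⋆ = b := upos_sa pb.
Let pc : upos c := upos_inv pb cb bc.
Let sc : c^⋆ = c := upos_sa pc.
Let np : n * p = 0. Proof. by rewrite mulrBl qp pp subrr. Qed.
Let pn : p * n = n. Proof. by rewrite mulrBr pq pp. Qed.
Let n'p : n^⋆ * p = n^⋆. Proof. by rewrite -{1}sp -ustarM pn. Qed.
Let pn' : p * n^⋆ = 0. Proof. by rewrite -{1}sp -ustarM np ustar0. Qed.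
Let nn : n * n = 0. Proof. by rewrite -{2}pn mulrA np mul0r. Qed.
Let n'n' : n^⋆ * n^⋆ = 0. Proof. by rewrite -ustarM nn ustar0. Qed.

Let KE : K = n - n^⋆.
Proof. by rewrite /K /n ustarB sp; ncring. Qed.

(** In blocks, n is the corner A of q, so b^2 is diagonal with entries 1 + A A^⋆ and 1 + A^⋆ A: b
    extends the operator B of the definition to the whole module. *)
Lemma matched_sq : b * b = 1 + n * n^⋆ + n^⋆ * n.
Proof.
rewrite bb -/K KE.
have -> : 1 - (n - n^⋆) * (n - n^⋆) =
    1 + n * n^⋆ + n^⋆ * n - n * n - n^⋆ * n^⋆ by ncring.
by rewrite nn n'n' !subr0.
Qed.

Let cbn : GRing.comm b n. Proof. exact: commrB. Qed.
Let cbn' : GRing.comm b n^⋆. Proof. exact: comm_star. Qed.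
Let cbq' : GRing.comm b q^⋆. Proof. exact: comm_star. Qed.
Let cbf : GRing.comm b f.
Proof. by apply: commrB => //; apply: commrB => //; exact: commr1. Qed.
Let cinv x : GRing.comm b x -> GRing.comm c x.
Proof. by move=> h; apply/commr_sym/(comm_inv cb bc)/commr_sym. Qed.
Let cbc : GRing.comm b c. Proof. by rewrite /GRing.comm cb. Qed.
Let cbK : GRing.comm b K. Proof. exact: commrB. Qed.
Let sf : f^⋆ = f.
Proof. by rewrite /f !ustarB ustarK ustar1; ncring. Qed.
Let sK : K^⋆ = - K. Proof. by rewrite ustarB ustarK opprB. Qed.
Let sw : w^⋆ = w.
Proof. by rewrite ustarM sc sf; apply/commr_sym/cinv. Qed.
Let sg : g^⋆ = g. Proof. by rewrite ustarB sb ustar1. Qed.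

Let ff : f * f = b * b.
Proof.
rewrite bb.
have -> : f * f = 1 - q - q^⋆ - q - q^⋆ + q * q + q^⋆ * q^⋆ + q * q^⋆ + q^⋆ * q.
  by rewrite /f; ncring.
have -> : 1 - (q - q^⋆) * (q - q^⋆) = 1 - q * q - q^⋆ * q^⋆ + q * q^⋆ + q^⋆ * q.
  by ncring.
by rewrite qq qq'; ncring.
Qed.

Let fK : f * K = - (K * f).
Proof.
have -> : f * K = q - q^⋆ - q * q + q^⋆ * q^⋆ + q * q^⋆ - q^⋆ * q.
  by rewrite /f /K; ncring.
have -> : K * f = q - q^⋆ - q * q + q^⋆ * q^⋆ - q * q^⋆ + q^⋆ * q.
  by rewrite /f /K; ncring.
by rewrite qq qq'; ncring.
Qed.

Let ww : w * w = 1.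
Proof.
have cf : GRing.comm c f by exact: cinv.
by rewrite /w -mulrA (mulrA f) -cf -(mulrA c f) ff (mulrA c b) cb mul1r cb.
Qed.

Let wK : w * K = - (K * w).
Proof.
have cK : GRing.comm c K by exact: cinv.
by rewrite /w -mulrA fK mulrN (mulrA c K f) cK mulrA.
Qed.

Let J := w * K.
Let sJ : J^⋆ = J. Proof. by rewrite ustarM sw sK mulNr -wK. Qed.
Let JJ : J * J = b * b - 1.
Proof.
have -> : J * J = w * (K * w) * K by rewrite /J !mulrA.
have -> : K * w = - (w * K) by rewrite wK opprK.
have -> : w * - (w * K) * K = - (w * w * (K * K)) by ncring.
by rewrite ww mul1r bb -/K; ncring.
Qed.
Let gg : b * b - 1 = g * g + g + g. Proof. by rewrite /g; ncring. Qed.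
Let cbw : GRing.comm b w. Proof. exact: commrM. Qed.
Let cgw : GRing.comm g w.
Proof. by apply/commr_sym/commrB; [exact: commr_sym | exact: commr1]. Qed.
Let cgJ : GRing.comm g J.
Proof.
apply: commrM => //; apply/commr_sym/commrB; first exact: commr_sym.
exact: commr1.
Qed.

(** The four blocks of m(q), with b, n, c, c d in the roles of B, A, B^-1, [B (B + I)]^-1. Only the
    first has to be cut down by p; the factors n and n^⋆ place the others. *)
Definition matched_expr : B := (2^-1 : R)%:C *:
  ((b + 1) * c * p + c * n + n^⋆ * c + n^⋆ * (c * d) * n).

(** The one nonlinear block simplifies because n^⋆ n = (b - 1) (b + 1) (1 - p): it equals (1 - c) (1
    - p). *)
Lemma matched_diff : matched_expr - q = (2^-1 : R)%:C *: (g * w - K).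
Proof.
rewrite -[in LHS](half_double q) /matched_expr -scalerBr; congr (_ *: _).
have n'n : n^⋆ * n = (b * b - 1) * (1 - p).
  have -> : (b * b - 1) * (1 - p) =
      n * n^⋆ - n * (n^⋆ * p) + n^⋆ * n - n^⋆ * (n * p).
    by rewrite matched_sq; ncring.
  by rewrite n'p np mulr0; ncring.
have cn' : GRing.comm c n^⋆ by exact: cinv.
have cdb : GRing.comm d b.
  have cd : GRing.comm b (b + 1) by apply: commrD; [exact: commr_refl|exact: commr1].
  exact: commr_sym (comm_inv db bd cd).
have dn' : GRing.comm d n^⋆.
  apply/commr_sym/(comm_inv db bd); apply: commrD; last exact: commr1.
  exact: commr_sym.
have -> : n^⋆ * (c * d) * n = (1 - c) * (1 - p).
  rewrite (mulrA n^⋆ c d) -cn' -(mulrA c) -dn' -!mulrA n'n.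
  have -> : d * ((b * b - 1) * (1 - p)) = d * (b + 1) * ((b - 1) * (1 - p)).
    by ncring.
  by rewrite db mul1r mulrA [c * (b - 1)]mulrBr cb mulr1.
have -> : (b + 1) * c = 1 + c by rewrite mulrDl bc mul1r.
have -> : g * w = (1 - c) * (1 - p - p - n - n^⋆).
  have <- : f = 1 - p - p - n - n^⋆ by rewrite /f /n ustarB sp; ncring.
  by rewrite /w /g mulrA [(b - 1) * c]mulrBl bc mul1r.
rewrite KE -cn'.
have -> : q = p + n by rewrite /n; ncring.
by ncring.
Qed.

(** Here g = (b^2 - 1) (b + 1)^-1 is a product of commuting positive elements, as b^2 - 1 = K^⋆
    K. *)
Let pg : upos g.
Proof.
have pd : upos d by apply: (upos_inv _ db bd); apply: uposD => //; exact: upos1.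
have pKK : upos (b * b - 1).
  have -> : b * b - 1 = K^⋆ * K by rewrite sK bb -/K; ncring.
  exact: upos_starM.
have -> : g = (b * b - 1) * d.
  by have -> : b * b - 1 = g * (b + 1); [rewrite /g; ncring | rewrite -mulrA bd mulr1].
apply: upos_mul => //.
by apply: (comm_inv db bd); apply: commrD; [|exact: commr1];
  apply/commr_sym/commrB; [apply: commrM; exact: commr_refl | exact: commr1].
Qed.

(** The reverse of the triangle inequality comes from 0 <= g <= |b| - 1, where |b| >= 1 because b^2
    >= 1. *)
Lemma norm_matched_root : nrm b = 1 + nrm g.
Proof.
have pbb : upos (b * b - 1).
  by rewrite gg; do 2 (apply: uposD => //); apply: upos_sq.
have b1 : 1 <= nrm b.
  have p1 : upos ((nrm (b * b))%:S - 1).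
    have -> : (nrm (b * b))%:S - 1 = ((nrm (b * b))%:S - b * b) + (b * b - 1).
      by ncring.
    by apply: uposD => //; apply: norm_le_upos => //; rewrite ustarM sb.
  have := upos_norm_le (unorm_ge0 _) (upos1 B) p1.
  rewrite unorm1 (unorm_sq sb).
  by have := unorm_ge0 b; move: (nrm b) => x; nra.
apply/eqP; rewrite eq_le; apply/andP; split.
  have {1}-> : b = 1 + g by rewrite /g; ncring.
  by rewrite -[X in _ <= X + _](unorm1 B) unormD.
rewrite addrC -lerBrDr; apply: upos_norm_le => //; first by rewrite subr_ge0.
have -> : (nrm b - 1)%:S - g = (nrm b)%:S - b by rewrite SB S1 /g; ncring.
exact: norm_le_upos.
Qed.

Lemma norm_matched_diff :
  nrm (matched_expr - q) = 2^-1 * (nrm g + Num.sqrt (nrm g ^+ 2 + 2 * nrm g)).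
Proof.
pose hf := (2^-1 : R)%:C.
have hfn a : nrm (hf *: a) = 2^-1 * nrm a by rewrite unormZr ger0_norm ?invr_ge0.
pose E := hf *: (g - J); pose E' := hf *: (g + J).
have nw : nrm w = 1.
  have := unorm_sq sw; rewrite ww unorm1 => h.
  by apply/eqP; rewrite -(@eqrXn2 _ 2%N)// ?unorm_ge0// -h expr1n.
have wD : w * (matched_expr - q) = E.
  rewrite matched_diff -scalerAr /E /J mulrBr; congr (_ *: (_ - _)).
  by rewrite mulrA -cgw -mulrA ww mulr1.
have Dw : matched_expr - q = w * E by rewrite -wD mulrA ww mul1r.
have -> : nrm (matched_expr - q) = nrm E.
  have := unormM w E; have := unormM w (matched_expr - q).
  by rewrite -Dw wD nw !mul1r => h1 h2; apply/eqP; rewrite eq_le h1 h2.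
have EE' : E' = w * E * w.
  rewrite /E /E' -scalerAr -scalerAl; congr (_ *: _).
  have wgw : w * g * w = g by rewrite -cgw -mulrA ww mulr1.
  have wJw : w * J * w = - J.
    have -> : w * J * w = w * w * (K * w) by rewrite /J !mulrA.
    by rewrite ww mul1r /J wK opprK.
  by rewrite [w * (g - J)]mulrBr mulrBl wgw wJw opprK.
have nE' : nrm E' <= nrm E.
  rewrite EE' (le_trans (unormM _ _))// nw mulr1 (le_trans (unormM _ _))//.
  by rewrite nw mul1r.
have sE : E^⋆ = E by rewrite /E ustarZr ustarB sg sJ.
have sE' : E'^⋆ = E' by rewrite /E' ustarZr ustarD sg sJ.
have g0 := unorm_ge0 g.
(* Triangle inequality, with |J|^2 = |J^2| = |g^2 + 2 g|. *)
have up : nrm E <= 2^-1 * (nrm g + Num.sqrt (nrm g ^+ 2 + 2 * nrm g)).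
  rewrite hfn ler_pM2l ?invr_gt0// (le_trans (unormD _ _))// unormN lerD//.
  rewrite -(ler_pXn2r (n := 2)) ?nnegrE ?unorm_ge0 ?sqrtr_ge0//.
  rewrite sqr_sqrtr ?addr_ge0 ?mulr_ge0 ?sqr_ge0//.
  rewrite -(unorm_sq sJ) JJ gg -addrA (le_trans (unormD _ _))//.
  rewrite unorm_sq// lerD2l mulrDl mul1r; exact: unormD.
apply/eqP; rewrite eq_le up /=.
set e := nrm E.
have e0 : 0 <= e by exact: unorm_ge0.
have pE : upos (e%:S - E) by exact: norm_le_upos.
have pE' : upos (e%:S - E') by exact: norm_le_upos.
have cE : GRing.comm E E'.
  apply/commr_sym/commZ/commr_sym/commZ; apply: commrD; apply/commr_sym/commrB => //;
  exact: commr_refl.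
(* Since E + E' = g and E E' = - g / 2, this is the product of the commuting positive elements e - E
   and e - E'. It yields (e + 1/2) |g| <= e^2, the input of [root_bound]. *)
have pm : upos ((e ^+ 2)%:S - (e + 2^-1)%:C *: g).
  have -> : (e ^+ 2)%:S - (e + 2^-1)%:C *: g = (e%:S - E) * (e%:S - E').
    have -> : (e%:S - E) * (e%:S - E') =
        e%:S * e%:S - e%:S * E' - E * e%:S + E * E' by ncring.
    rewrite !mulSl !mulSr scalerA -rmorphM -expr2.
    have -> : E * E' = - (hf *: g).
      rewrite /E /E' -scalerAl -scalerAr.
      have -> : (g - J) * (g + J) = g * g - J * J + (g * J - J * g) by ncring.
      rewrite cgJ subrr addr0 JJ gg.
      have -> : g * g - (g * g + g + g) = - (g + g) by ncring.
      by rewrite scalerN half_double scalerN.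
    rewrite -addrA -opprD -addrA -opprD; congr (_ - _).
    rewrite addrA -scalerDr -scalerDr.
    have -> : g + J + (g - J) = g + g by ncring.
    by rewrite half_double -scalerDl -rmorphD.
  apply: upos_mul => //; apply/commr_sym/commrB; first exact: commS.
  by apply/commr_sym/commrB; first exact: commS.
have := upos_norm_le (sqr_ge0 e) _ pm.
have e1 : 0 <= e + 2^-1 by rewrite addr_ge0 ?invr_ge0.
rewrite unormZr (ger0_norm e1) => /(_ (uposZ e1 pg)) h.
have s0 : 0 <= nrm g ^+ 2 + 2 * nrm g by rewrite addr_ge0 ?mulr_ge0 ?sqr_ge0.
exact: root_bound h g0 e0 (sqrtr_ge0 _) (sqr_sqrtr s0).
Qed.

(** From q q^⋆ = p b^2 one gets |q| <= |b|. Conversely, |q|^2 bounds the upper diagonal block of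
    b^2, and the lower block has no larger a bound since |n^⋆ n| = |n n^⋆|. A nonzero q is needed
    for |q| >= 1; for q = 0 one has b = 1. *)
Lemma norm_idempotent : q != 0 -> nrm q = nrm b.
Proof.
move=> q0; have q0' := unorm_neq0 q0.
have q1 : 1 <= nrm q.
  by rewrite -(ler_pM2r q0') mul1r -{1}qq unormM.
have qE : q * q^⋆ = p * (b * b).
  have -> : q = p + n by rewrite /n; ncring.
  rewrite ustarD sp matched_sq.
  have -> : (p + n) * (p + n^⋆) = p * p + p * n^⋆ + n * p + n * n^⋆ by ncring.
  have -> : p * (1 + n * n^⋆ + n^⋆ * n) = p + (p * n) * n^⋆ + (p * n^⋆) * n.
    by ncring.
  by rewrite pp pn pn' np; ncring.
have nqq : nrm (q * q^⋆) = nrm q ^+ 2.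
  by rewrite -{1}[q]ustarK unorm_starM unorm_star.
have nbb : nrm (b * b) = nrm b ^+ 2 by exact: unorm_sq.
suff : nrm q ^+ 2 = nrm b ^+ 2.
  by move/eqP; rewrite eqrXn2 ?unorm_ge0// => /eqP.
apply/eqP; rewrite eq_le; apply/andP; split.
  rewrite -nqq -nbb qE (le_trans (unormM _ _))// ler_piMl ?unorm_ge0//.
  have := unorm_sq sp; rewrite pp; have := unorm_ge0 p; move: (nrm p) => x; nra.
set G := nrm q ^+ 2.
have G1 : 0 <= G - 1 by rewrite subr_ge0 exprn_ege1.
pose p' := 1 - p.
have sp' : p'^⋆ = p' by rewrite ustarB sp ustar1.
have pp' : p' * p' = p' .
  have -> : p' * p' = 1 - p - p + p * p by rewrite /p'; ncring.
  by rewrite pp /p'; ncring.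
have pp0 : upos p' by rewrite -pp'; exact: upos_sq.
have pA : upos (p * (G%:S - q * q^⋆) * p).
  rewrite -{1}sp; apply: upos_conj; apply: norm_le_upos.
    by rewrite ustarM ustarK.
  by rewrite nqq.
have AE : p * (G%:S - q * q^⋆) * p = G%:C *: p - p - n * n^⋆.
  rewrite qE matched_sq.
  have -> : p * (G%:S - p * (1 + n * n^⋆ + n^⋆ * n)) * p =
     p * G%:S * p - (p * p) * p - (p * p) * n * (n^⋆ * p) - p * (p * n^⋆) * n * p.
    by ncring.
  by rewrite mulSr -scalerAl !pp pn n'p pn' mulr0 !mul0r subr0.
(* Compressing G - q q^⋆ >= 0 by p gives n n^⋆ <= (G - 1) p. *)
have nn'G : nrm (n^⋆ * n) <= G - 1.
  rewrite unorm_starM -(unorm_star n) -unorm_starM ustarK.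
  apply: upos_norm_le => //.
    by rewrite -{1}[n]ustarK; exact: upos_starM.
  have -> : (G - 1)%:S - n * n^⋆ =
      p * (G%:S - q * q^⋆) * p + (G - 1)%:C *: p'.
    by rewrite AE /p' scalerBr SB S1 rmorphB rmorph1 scalerBl scale1r; ncring.
  by apply: uposD => //; exact: uposZ.
rewrite -nbb; apply: upos_norm_le; rewrite ?sqr_ge0//; first exact: upos_sq.
(* Block diagonal decomposition of G - b^2 along p and 1 - p. *)
have -> : G%:S - b * b =
   p * (G%:S - q * q^⋆) * p + p'^⋆ * ((G - 1)%:S - n^⋆ * n) * p'.
  rewrite AE sp'.
  have -> : p' * ((G - 1)%:S - n^⋆ * n) * p' = (G - 1)%:C *: p' - n^⋆ * n.
    rewrite [p' * (_%:S - _)]mulrBr mulrBl mulSr -scalerAl pp'; congr (_ - _).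
    rewrite /p'; have -> : (1 - p) * (n^⋆ * n) * (1 - p) =
      n^⋆ * n - p * n^⋆ * n - n^⋆ * (n * p) + p * n^⋆ * n * p by ncring.
    by rewrite pn' np; ncring.
  by rewrite matched_sq /p' scalerBr rmorphB rmorph1 !scalerBl !scale1r; ncring.
by apply: uposD => //; apply: upos_conj; apply: norm_le_upos => //;
  rewrite ustarM ustarK.
Qed.

Lemma matched_theorem : q != 0 ->
  nrm (matched_expr - q) = 2^-1 * (nrm q - 1 + Num.sqrt (nrm q ^+ 2 - 1)).
Proof.
move=> q0; rewrite norm_matched_diff norm_idempotent// norm_matched_root.
congr (_ * _); congr (_ + _); first by ring.
by congr Num.sqrt; ring.
Qed.

End MatchedNorm.

End Idempotent.

(** * Bounded operators on a Hilbert module *)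

Section AdjointCalculus.
Variables (R : realType) (A : cstarAlgType R).

Lemma adjop_ext (E F : hermModType A) (S T : 'L(E, F)) :
  (forall x, S x = T x) -> S = T.
Proof. by move=> h; apply: val_inj; apply: funext. Qed.

Lemma adjopBE (E F : hermModType A) (S T : 'L(E, F)) x : (S - T) x = S x - T x.
Proof. by []. Qed.

Lemma adjopZE (E F : hermModType A) (k : R[i]) (T : 'L(E, F)) x :
  (k *: T) x = k *: T x.
Proof. by []. Qed.

Lemma opcompE (E F G : hermModType A) (S : 'L(F, G)) (T : 'L(E, F)) x :
  (S ∘ T) x = S (T x).
Proof. by []. Qed.

Lemma ipBr (E : hermModType A) (x y z : E) : ip x (y - z) = ip x y - ip x z :> A.
Proof. by rewrite -scaleN1r ipDr ipZr scaleN1r. Qed.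

Section Linear.
Variables (E F : innerProductModType A) (T : 'L(E, F)).

Lemma adjopD x y : T (x + y) = T x + T y.
Proof. by have := adjop_linear T 1 x y; rewrite !scale1r. Qed.

Lemma adjopZ (k : R[i]) x : T (k *: x) = k *: T x.
Proof. by have := adjop_linear T k x 0; rewrite !addr0 adjop0 addr0. Qed.

End Linear.

Lemma is_adjoint_sym (E F : hermModType A) (T : E -> F) (S : F -> E) :
  is_adjoint T S -> is_adjoint S T.
Proof. by move=> h x y; rewrite -ip_star -h ip_star. Qed.

(** [adj] is chosen, not computed; definiteness of the inner product on E lets any exhibited adjoint
    be identified with it. *)
Lemma adj_unique (E : innerProductModType A) (F : hermModType A) (T : 'L(E, F))
    (S : 'L(F, E)) : is_adjoint T S -> adj T = S.
Proof.
move=> h; apply: adjop_ext => y; apply: ip_inj => x.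
by rewrite adjP' (is_adjoint_sym h).
Qed.

Lemma adj_comp (E F G : innerProductModType A) (S : 'L(F, G)) (T : 'L(E, F)) :
  adj (S ∘ T) = adj T ∘ adj S.
Proof. by apply: adj_unique => x y /=; rewrite !adjP. Qed.

Lemma adjK (E F : innerProductModType A) (T : 'L(E, F)) : adj (adj T) = T.
Proof. by apply: adj_unique; exact: adjP'. Qed.

Lemma adjD (E F : innerProductModType A) (S T : 'L(E, F)) :
  adj (S + T) = adj S + adj T.
Proof. by apply: adj_unique => x y; rewrite /= ipDl ipDr !adjP. Qed.

Lemma adjZ (E F : innerProductModType A) (k : R[i]) (T : 'L(E, F)) :
  adj (k *: T) = k^*%R *: adj T.
Proof. by apply: adj_unique => x y; rewrite /= ipZl ipZr adjP. Qed.

End AdjointCalculus.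

Section BoundedOperators.
Variables (R : realType) (A : cstarAlgType R) (E : hilbertModType A).
(** A hypothesis for now: its general proof uses the results of this section for A as a module over
    itself. *)
Hypothesis cauchy_schwarz : forall x y : E,
  rnorm (ip x y : A) <= rnorm x * rnorm y.
Implicit Types (S T : 'L(E)) (x y : E).

Lemma rnorm_ip x : rnorm x ^+ 2 = rnorm (ip x x : A).
Proof.
apply: (@complexI R); rewrite -rnormE -hnormE rnormE.
by rewrite rmorphXn.
Qed.


(* Uniform boundedness by a gliding hump: if [T] were unbounded, a series      *)
(* [\sum_n e_n 4^-n v_n], [e_n] in {0, 1}, with unit vectors [v_n] along       *)
(* [T y_n] would have inner products with [T y_n], hence those of its image    *)
(* by the adjoint with [y_n], tending to infinity.                             *)
Lemma adjop_bounded T : exists M, forall x, rnorm (T x) <= M * rnorm x.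
Proof.
apply: contrapT => unb.
have big (M : R) : exists y, rnorm y <= 1 /\ M < rnorm (T y).
  apply: contrapT => nb; apply: unb; exists M => x; rewrite leNgt.
  apply/negP => lt; apply: nb.
  have [x0|x0] := eqVneq x 0.
    by move: lt; rewrite x0 adjop0 !rnorm0 mulr0 ltxx.
  have xp : 0 < rnorm x.
    rewrite lt_def rnorm_ge0 andbT; apply: contraNneq x0 => h.
    by apply/eqP/rnorm_eq0.
  exists ((rnorm x)^-1%:C *: x).
  rewrite adjopZ !rnormZr gtr0_norm ?invr_gt0// mulVf ?gt_eqF//; split => //.
  by rewrite ltr_pdivlMl// mulrC.
(* With a = |T y_n|, the hump guarantees a 4^-n / 2 and the later terms take away at most a 4^-n /
   3; the remaining a 4^-n / 6 exceeds n. *)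
have [y hy] := choice (fun n : nat => big (6 * n%:R * 4 ^+ n)).
pose a n := rnorm (T (y n)).
have a_gt0 n : 0 < a n.
  by apply: le_lt_trans (hy n).2; rewrite !mulr_ge0// exprn_ge0.
pose v n := ((a n)^-1 * 4 ^- n)%:C *: T (y n).
have nv n : rnorm (v n) = 4 ^- n.
  rewrite rnormZr ger0_norm ?mulr_ge0 ?invr_ge0 ?exprn_ge0 ?(ltW (a_gt0 n))//.
  by rewrite mulrAC mulVf ?mul1r// lt0r_neq0 ?a_gt0.
have ipv n : rnorm (ip (T (y n)) (v n) : A) = a n * 4 ^- n.
  rewrite ipZr rnormZr -rnorm_ip -/(a n).
  rewrite ger0_norm ?mulr_ge0 ?invr_ge0 ?exprn_ge0 ?(ltW (a_gt0 n))//.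
  by move: (4 ^- n) => z; field; exact: lt0r_neq0 (a_gt0 n).
pose good n (z : E) := a n * 4 ^- n / 2 <= rnorm (ip (T (y n)) z : A).
(* By the triangle inequality, z or z + v_n is good. *)
have step n z : exists z', rnorm (z' - z) <= 4 ^- n /\ good n z'.
  have [h|h] := leP (a n * 4 ^- n / 2) (rnorm (ip (T (y n)) z : A)).
    by exists z; rewrite subrr rnorm0 invr_ge0 exprn_ge0.
  exists (z + v n); rewrite addrC addKr nv lexx; split=> //.
  rewrite /good ipDr.
  have : rnorm (ip (T (y n)) (v n) : A) <=
      rnorm (ip (T (y n)) z + ip (T (y n)) (v n) : A) + rnorm (ip (T (y n)) z : A).
    rewrite -[X in _ <= _ + X]rnormN.
    by rewrite (le_trans _ (rnormD _ _))// addrAC subrr add0r.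
  rewrite ipv; move: h; move: (rnorm _) (rnorm _) (a n * _) => p q r; lra.
have [nxt hn] := choice (fun p : nat * E => step p.1 p.2).
pose u := fix u n := if n is m.+1 then nxt (m.+1, u m) else 0 : E.
(* Its increments are 4^-(n+1) and it stays below 0, so the tail after n is at most 4^-n / 3. *)
pose t n : R := - (3^-1 * 4 ^- n).
have ut n : rnorm (u n.+1 - u n) <= t n.+1 - t n.
  have -> : t n.+1 - t n = 4 ^- n.+1.
      by rewrite /t exprS invfM; move: (4 ^- n) => z; lra.
  exact: (hn (n.+1, u n)).1.
have t0 n : t n <= 0 by rewrite oppr_le0 mulr_ge0 ?invr_ge0 ?exprn_ge0.
have tS n : t n <= t n.+1 by rewrite -subr_ge0 (le_trans (rnorm_ge0 _) (ut n)).
have [s [s0 ts hs]] := majorant_sup t0 tS.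
have [x hx] := majorized_cvg ut hs ts.
have lower n : n.+1%:R <= rnorm (adj T x).
  have gd : good n.+1 (u n.+1) := (hn (n.+1, u n)).2.
  have e1 : rnorm (ip (T (y n.+1)) (x - u n.+1) : A) <= a n.+1 * (3^-1 * 4 ^- n.+1).
    rewrite (le_trans (cauchy_schwarz _ _))// ler_wpM2l ?rnorm_ge0//.
    by rewrite (le_trans (hx _))// /t; lra.
  have e2 : rnorm (ip (T (y n.+1)) x : A) <= rnorm (adj T x).
    rewrite adjP (le_trans (cauchy_schwarz _ _))// ler_piMl ?rnorm_ge0//.
    exact: (hy n.+1).1.
  have e3 : rnorm (ip (T (y n.+1)) (u n.+1) : A) <=
      rnorm (ip (T (y n.+1)) x : A) + rnorm (ip (T (y n.+1)) (x - u n.+1) : A).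
    have -> : u n.+1 = x - (x - u n.+1) by rewrite opprB addrC subrK.
    rewrite opprB addrCA subrr addr0.
    rewrite {1}(_ : u n.+1 = x + - (x - u n.+1)); last by rewrite opprB addrC subrK.
    rewrite ipDr (le_trans (rnormD _ _))// lerD2l.
    by rewrite -scaleN1r ipZr scaleN1r rnormN.
  have e4 : 6 * n.+1%:R < a n.+1 * 4 ^- n.+1.
    by rewrite ltr_pdivlMr ?exprn_gt0// (hy n.+1).2.
  move: gd e1 e2 e3 e4; rewrite /good.
  have -> : a n.+1 * (3^-1 * 4 ^- n.+1) = 3^-1 * (a n.+1 * 4 ^- n.+1) by ring.
  move: (rnorm _) (rnorm (ip _ (_ - _))) (rnorm (ip _ x)) (rnorm _).
  by move: (a n.+1 * _) (n.+1%:R : R) => b5 b6 b1 b2 b3 b4; lra.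
have := lower (Num.bound (rnorm (adj T x))).
have := archi_boundP (rnorm_ge0 (adj T x)); rewrite -natr1; lra.
Qed.

Lemma Re_normr x : complex.Re `|x| = rnorm x. Proof. by []. Qed.

Lemma norm_le1 x : (`|x| <= 1) = (rnorm x <= 1).
Proof. by rewrite rnormE -[1](rmorph1 (real_complex R)) lecR. Qed.

Lemma opnorm_has_sup T :
  has_sup [set complex.Re `|T x| | x in [set x : E | `|x| <= 1]].
Proof.
split; first by exists (complex.Re `|T 0|); exists 0 => //=; rewrite normr0 ler01.
have [M hM] := adjop_bounded T; exists `|M| => _ [x /= x1 <-].
rewrite norm_le1 in x1; rewrite (le_trans (hM x))//.
have := ler_norm M; have := normr_ge0 M; have := rnorm_ge0 x; move: x1.
by move: (rnorm x) `|M| => r m; nra.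
Qed.

Lemma opnorm_ub T x : rnorm (T x) <= opnorm T * rnorm x.
Proof.
have [x0|x0] := eqVneq x 0; first by rewrite x0 adjop0 !rnorm0 mulr0.
have xp : 0 < rnorm x.
  rewrite lt_def rnorm_ge0 andbT; apply: contraNneq x0 => h.
  by apply/eqP/rnorm_eq0.
rewrite -ler_pdivrMr//; apply: ub_le_sup; first exact: (opnorm_has_sup T).2.
exists ((rnorm x)^-1%:C *: x).
  by rewrite /= norm_le1 rnormZr gtr0_norm ?invr_gt0// mulVf ?gt_eqF.
by rewrite Re_normr adjopZ rnormZr gtr0_norm ?invr_gt0// mulrC.
Qed.

Lemma opnorm_le T (M : R) : 0 <= M -> (forall x, rnorm (T x) <= M * rnorm x) ->
  opnorm T <= M.
Proof.
move=> M0 h; apply: ge_sup; first exact: (opnorm_has_sup T).1.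
move=> _ [x /= x1 <-]; rewrite norm_le1 in x1; rewrite (le_trans (h x))//.
by rewrite ler_piMr.
Qed.

Lemma opnorm_ge0 T : 0 <= opnorm T.
Proof.
apply: le_trans (_ : rnorm (T 0) <= _); first exact: rnorm_ge0.
apply: ub_le_sup; first exact: (opnorm_has_sup T).2.
by exists 0 => //=; rewrite normr0 ler01.
Qed.

Lemma opnorm_eq0 T : opnorm T = 0 -> T = 0.
Proof.
move=> h; apply: adjop_ext => x; apply: rnorm_eq0; apply/eqP.
by rewrite eq_le rnorm_ge0 andbT; have := opnorm_ub T x; rewrite h mul0r.
Qed.

Lemma opnormD S T : opnorm (S + T) <= opnorm S + opnorm T.
Proof.
apply: opnorm_le; first by rewrite addr_ge0 ?opnorm_ge0.
by move=> x; rewrite (le_trans (rnormD _ _))// mulrDl lerD ?opnorm_ub.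
Qed.

Lemma opnormZ (k : R[i]) T : opnorm (k *: T) = complex.Re `|k| * opnorm T.
Proof.
have le (c : R[i]) (U : 'L(E)) : opnorm (c *: U) <= complex.Re `|c| * opnorm U.
  have c0 : 0 <= complex.Re `|c| by rewrite normc_def/= sqrtr_ge0.
  apply: opnorm_le; first by rewrite mulr_ge0 ?opnorm_ge0.
  by move=> x; rewrite adjopZE rnormZ -mulrA ler_wpM2l ?opnorm_ub.
have [->|k0] := eqVneq k 0.
  apply/eqP; rewrite normr0 mul0r eq_le opnorm_ge0 andbT.
  by have := le 0 T; rewrite normr0 mul0r.
apply/eqP; rewrite eq_le le andTb.
have kE : `|k| = (complex.Re `|k|)%:C by rewrite normc_def.
have kp : 0 < complex.Re `|k| by rewrite -ltcR -kE normr_gt0.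
have := le k^-1 (k *: T); rewrite scalerA mulVf// scale1r.
have -> : complex.Re `|k^-1| = (complex.Re `|k|)^-1.
  by rewrite normfV kE -fmorphV.
by rewrite ler_pdivlMl.
Qed.

Lemma opnormM S T : opnorm (S ∘ T) <= opnorm S * opnorm T.
Proof.
apply: opnorm_le; first by rewrite mulr_ge0 ?opnorm_ge0.
move=> x; rewrite opcompE (le_trans (opnorm_ub _ _))// -mulrA.
by rewrite ler_wpM2l ?opnorm_ge0 ?opnorm_ub.
Qed.

Lemma opnorm_adj_le T : opnorm (adj T) <= opnorm T.
Proof.
apply: opnorm_le; first exact: opnorm_ge0.
move=> x; set y := adj T x; have [y0|y0] := eqVneq (rnorm y) 0.
  by rewrite y0 mulr_ge0 ?opnorm_ge0 ?rnorm_ge0.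
have yp : 0 < rnorm y by rewrite lt_def y0 rnorm_ge0.
rewrite -(ler_pM2r yp) -expr2 rnorm_ip {1}/y adjP'.
rewrite (le_trans (cauchy_schwarz _ _))//.
rewrite [opnorm T * _]mulrC -mulrA.
by rewrite ler_wpM2l ?rnorm_ge0// opnorm_ub.
Qed.

Lemma opnorm_adjM T : opnorm (adj T ∘ T) = opnorm T ^+ 2.
Proof.
apply/eqP; rewrite eq_le; apply/andP; split.
  by rewrite (le_trans (opnormM _ _))// expr2 ler_wpM2r ?opnorm_ge0 ?opnorm_adj_le.
set N := opnorm (adj T ∘ T).
have N0 : 0 <= N by exact: opnorm_ge0.
rewrite -(sqr_sqrtr N0) lerXn2r ?nnegrE ?sqrtr_ge0 ?opnorm_ge0//.
apply: opnorm_le; first exact: sqrtr_ge0.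
move=> x; rewrite -(ler_pXn2r (n := 2)) ?nnegrE ?rnorm_ge0//; last first.
  by rewrite mulr_ge0 ?sqrtr_ge0 ?rnorm_ge0.
rewrite exprMn sqr_sqrtr// rnorm_ip adjP (le_trans (cauchy_schwarz _ _))//.
rewrite mulrC expr2 mulrA ler_wpM2r ?rnorm_ge0//.
exact: (opnorm_ub (adj T ∘ T)).
Qed.

(** The adjoints obey the same majorant, so both sequences converge pointwise, and the adjoint
    relation passes to the limits. Adjointability of the limit then includes its linearity. *)
Lemma opnorm_complete (u : nat -> 'L(E)) (t : nat -> R) (s : R) :
  (forall n, opnorm (u n.+1 - u n) <= t n.+1 - t n) ->
  (forall e, 0 < e -> exists n, forall m, (n <= m)%N -> s - t m < e) ->
  (forall n, t n <= s) ->
  exists l, forall n, opnorm (l - u n) <= s - t n.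
Proof.
move=> ut hs ts.
have ptw (v : nat -> 'L(E)) : (forall n, opnorm (v n.+1 - v n) <= t n.+1 - t n) ->
    exists L : E -> E, forall x n, rnorm (L x - v n x) <= (s - t n) * rnorm x.
  move=> vt.
  suff /choice[L hL] : forall x, exists l : E, forall n,
      rnorm (l - v n x) <= (s - t n) * rnorm x by exists L.
  move=> x.
  have [||n|l hl] := @majorized_cvg R E (fun n => v n x)
    (fun n => t n * rnorm x) (s * rnorm x).
  - move=> n; rewrite -mulrBl -adjopBE (le_trans (opnorm_ub _ _))//.
    by rewrite ler_wpM2r ?rnorm_ge0.
  - move=> e e0; have r0 : 0 < rnorm x + 1 by rewrite ltr_wpDl// rnorm_ge0.
    have [n hn] := hs (e / (rnorm x + 1)) (divr_gt0 e0 r0).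
    exists n => m nm; have := hn m nm; rewrite ltr_pdivlMr// -mulrBl.
    have := ts m; have := rnorm_ge0 x; move: (rnorm x) (t m) => r t0; nra.
  - by rewrite ler_wpM2r ?rnorm_ge0.
  - by exists l => n; rewrite mulrBl.
have [L hL] := ptw u ut.
have [|L' hL'] := ptw (fun n => adj (u n)).
  move=> n; rewrite -scaleN1r -[-1](_ : (-1)^*%R = _); last by rewrite rmorphN rmorph1.
  rewrite -adjZ -adjD scaleN1r; exact: le_trans (opnorm_adj_le _) (ut n).
have LL' : is_adjoint L L'.
  move=> x y; apply/eqP; rewrite -subr_eq0; apply/eqP.
  apply: (@rnorm_le_eq0 _ _ _ (2 * (rnorm x * rnorm y))).
    by rewrite !mulr_ge0 ?rnorm_ge0.
  move=> e e0; have [n hn] := hs _ e0.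
  have -> : ip (L x) y - ip x (L' y) =
      ip (L x - u n x) y - ip x (L' y - adj (u n) y) :> A.
    by rewrite ipBl ipBr adjP opprB addrA subrK.
  rewrite (le_trans (rnormD _ _))// rnormN.
  have h1 := cauchy_schwarz (L x - u n x) y.
  have h2 := cauchy_schwarz x (L' y - adj (u n) y).
  have h3 := hL x n; have h4 := hL' y n; have h5 := ltW (hn n (leqnn n)).
  have h6 := rnorm_ge0 x; have h7 := rnorm_ge0 y.
  apply: le_trans (lerD h1 h2) _.
  have h8 : rnorm (L x - u n x) * rnorm y <= (s - t n) * rnorm x * rnorm y.
    exact: ler_wpM2r.
  have h9 : rnorm x * rnorm (L' y - adj (u n) y) <= rnorm x * ((s - t n) * rnorm y).
    exact: ler_wpM2l.
  apply: le_trans (lerD h8 h9) _.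
  have -> : (s - t n) * rnorm x * rnorm y + rnorm x * ((s - t n) * rnorm y) =
    2 * (rnorm x * rnorm y) * (s - t n) by ring.
  by rewrite ler_wpM2l// !mulr_ge0.
exists (mkadj LL') => n; apply: opnorm_le; first by rewrite subr_ge0.
by move=> x; exact: hL.
Qed.

End BoundedOperators.

(** * The Cauchy-Schwarz inequality *)

Section BoundedOps.
Variables (R : realType) (A : cstarAlgType R) (E : hilbertModType A).

Definition cauchy_schwarz : Prop :=
  forall x y : E, rnorm (ip x y : A) <= rnorm x * rnorm y.

(* [adjop E E] carrying the proofs that its C*-algebra structure requires. *)
Definition bounded_ops (cs : cauchy_schwarz) (nz : exists x : E, x <> 0) : Type :=
  'L(E).

Variables (cs : cauchy_schwarz) (nz : exists x : E, x <> 0).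
Let B := bounded_ops cs nz.

HB.instance Definition _ := GRing.Lmodule.on B.

Let opcompA : associative (fun S T : B => S ∘ T : B).
Proof. by move=> S T U; exact: adjop_ext. Qed.
Let opcomp1l : left_id (opid E : B) (fun S T : B => S ∘ T : B).
Proof. by move=> T; exact: adjop_ext. Qed.
Let opcomp1r : right_id (opid E : B) (fun S T : B => S ∘ T : B).
Proof. by move=> T; exact: adjop_ext. Qed.
Let opcompDl : left_distributive (fun S T : B => S ∘ T : B) +%R.
Proof. by move=> S T U; exact: adjop_ext. Qed.
Let opcompDr : right_distributive (fun S T : B => S ∘ T : B) +%R.
Proof. by move=> S T U; apply: adjop_ext => x; rewrite /= adjopD. Qed.
(** The ring structure demands 1 <> 0, whence the nonzero vector among the parameters. *)
Let opid_neq0 : (opid E : B) != 0.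
Proof.
apply/eqP => h; case: nz => x; apply.
by rewrite -[x]/(opid E x) (h : opid E = 0).
Qed.

HB.instance Definition _ := GRing.Zmodule_isNzRing.Build B
  opcompA opcomp1l opcomp1r opcompDl opcompDr opid_neq0.

Let opcompZl (k : R[i]) (S T : B) : k *: (S * T) = (k *: S) * T.
Proof. exact: adjop_ext. Qed.

HB.instance Definition _ := GRing.Lmodule_isLalgebra.Build R[i] B opcompZl.

Let opcompZr (k : R[i]) (S T : B) : k *: (S * T) = S * (k *: T).
Proof. by apply: adjop_ext => x; rewrite /= adjopZ. Qed.

HB.instance Definition _ := GRing.Lalgebra_isAlgebra.Build R[i] B opcompZr.

Let star (T : B) : B := adj T.
Let norm (T : B) : R := opnorm T.

Let starK : involutive star. Proof. by move=> T; exact: adjK. Qed.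
Let starD : {morph star : a b / a + b}. Proof. by move=> S T; exact: adjD. Qed.
Let starZ (k : R[i]) a : star (k *: a) = k^*%R *: star a. Proof. exact: adjZ. Qed.
Let starM a b : star (a * b) = star b * star a. Proof. exact: adj_comp. Qed.
Let norm_eq0 a : norm a = 0 -> a = 0. Proof. exact: opnorm_eq0. Qed.
Let normD a b : norm (a + b) <= norm a + norm b. Proof. exact: opnormD. Qed.
Let normZ (k : R[i]) a : norm (k *: a) = complex.Re `|k| * norm a.
Proof. exact: opnormZ. Qed.
Let normM a b : norm (a * b) <= norm a * norm b. Proof. exact: opnormM. Qed.
Let norm_starM a : norm (star a * a) = norm a ^+ 2. Proof. exact: opnorm_adjM. Qed.
Let complete (u : nat -> B) (t : nat -> R) (s : R) :
  (forall n, norm (u n.+1 - u n) <= t n.+1 - t n) ->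
  (forall e, 0 < e -> exists n, forall m, (n <= m)%N -> s - t m < e) ->
  (forall n, t n <= s) ->
  exists l, forall n, norm (l - u n) <= s - t n.
Proof. exact: opnorm_complete. Qed.

HB.instance Definition _ := isUnitalCstar.Build R B starK starD starZ starM
  norm_eq0 normD normZ normM norm_starM complete.

End BoundedOps.

(** * A C*-algebra as a Hilbert module over itself *)

Section SelfModule.
Variables (R : realType) (A : cstarAlgType R).
Implicit Types a b : A.

Definition self_mod : Type := A.

HB.instance Definition _ := CompleteNormedModule.on self_mod.

Let sract (x : self_mod) (a : A) : self_mod := cmul (x : A) a.
Let sip (x y : self_mod) : A := cmul (cstar (x : A)) (y : A).

Let sractDl x y a : sract (x + y) a = sract x a + sract y a.
Proof. exact: cmulDl. Qed.
Let sractDr x a b : sract x (a + b) = sract x a + sract x b.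
Proof. exact: cmulDr. Qed.
Let sractM x a b : sract x (cmul a b) = sract (sract x a) b.
Proof. exact: cmulA. Qed.
Let sractZl (k : R[i]) x a : k *: sract x a = sract (k *: x) a.
Proof. exact: cscalerAl. Qed.
Let sractZr (k : R[i]) x a : k *: sract x a = sract x (k *: a).
Proof. exact: cscalerAr. Qed.
Let sipDr x y z : sip x (y + z) = sip x y + sip x z.
Proof. exact: cmulDr. Qed.
Let sipZr (k : R[i]) x y : sip x (k *: y) = k *: sip x y.
Proof. by rewrite /sip -cscalerAr. Qed.
Let sip_ract x y a : sip x (sract y a) = cmul (sip x y) a.
Proof. exact: cmulA. Qed.
Let sip_star x y : cstar (sip x y) = sip y x.
Proof. by rewrite /sip cstarM cstarK. Qed.

HB.instance Definition _ := isHermModule.Build R A self_mod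
  sractDl sractDr sractM sractZl sractZr sipDr sipZr sip_ract sip_star.

Let sip_ge0 (x : self_mod) : cpositive (ip x x : A).
Proof. by exists x. Qed.
Let sip_eq0 (x : self_mod) : (ip x x : A) = 0 -> x = 0.
Proof.
move=> x0; apply/eqP; rewrite -normr_eq0 -sqrf_eq0.
by rewrite -(cnorm_starM (x : A)) [cmul _ _]x0 normr0.
Qed.

HB.instance Definition _ := HermModule_isInnerProduct.Build R A self_mod
  sip_ge0 sip_eq0.

Let snormE (x : self_mod) : `|x| ^+ 2 = `|ip x x : A|.
Proof. by rewrite -(cnorm_starM (x : A)). Qed.

HB.instance Definition _ := InnerProduct_isHilbert.Build R A self_mod snormE.

Lemma rnorm_cmul a b : rnorm (cmul a b) <= rnorm a * rnorm b.
Proof. by rewrite -lecR rmorphM /= -!rnormE; exact: cnormM_le. Qed.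

Lemma rnorm_starM a : rnorm (cmul (cstar a) a) = rnorm a ^+ 2.
Proof.
apply: (@complexI R); rewrite rmorphXn /= -!rnormE.
exact: cnorm_starM.
Qed.

Lemma rnorm_cstar a : rnorm (cstar a) = rnorm a.
Proof.
suff h b : rnorm b <= rnorm (cstar b).
  by apply/eqP; rewrite eq_le h -{2}[a]cstarK h.
have [->|b0] := eqVneq (rnorm b) 0; first exact: rnorm_ge0.
have bp : 0 < rnorm b by rewrite lt_def b0 rnorm_ge0.
by rewrite -(ler_pM2r bp) -expr2 -rnorm_starM rnorm_cmul.
Qed.

Lemma self_cauchy_schwarz : cauchy_schwarz self_mod.
Proof. by move=> x y; rewrite (le_trans (rnorm_cmul _ _))// rnorm_cstar. Qed.

Lemma lmul_adjoint a :
  @is_adjoint R A self_mod self_mod (fun x => cmul a x) (fun x => cmul (cstar a) x).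
Proof. by move=> x y; rewrite /ip /= /sip cstarM cmulA. Qed.

(** Embeds the possibly nonunital A isometrically into a unital C*-algebra, where the theory of
    [upos] is available. *)
Definition lmul a : 'L(self_mod) := mkadj (@lmul_adjoint a).

Lemma opnorm_lmul a : opnorm (lmul a) = rnorm a.
Proof.
apply/eqP; rewrite eq_le; apply/andP; split.
  apply: (opnorm_le self_cauchy_schwarz); first exact: rnorm_ge0.
  by move=> x; exact: rnorm_cmul.
have [->|a0] := eqVneq (rnorm a) 0; first exact: opnorm_ge0 self_cauchy_schwarz _.
have ap : 0 < rnorm a by rewrite lt_def a0 rnorm_ge0.
rewrite -(ler_pM2r ap) -expr2 -{1}(rnorm_cstar a) -rnorm_starM cstarK.
by rewrite -(rnorm_cstar a); exact: (opnorm_ub self_cauchy_schwarz (lmul a)).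
Qed.

End SelfModule.

Section CauchySchwarz.
Variables (R : realType) (A : cstarAlgType R).

(* [|y|^2 <x, x> - <x, y> <y, x>] is positive in the algebra generated by      *)
(* left multiplications and the unit, by expanding the inner square of         *)
(* [x - |y|^-2 y <y, x>].                                                      *)
Theorem cauchy_schwarz_hilbert (H : hilbertModType A) : cauchy_schwarz H.
Proof.
move=> x y.
(* If A = 0 all inner products vanish; otherwise ['L(A)] is a nonzero ring. *)
have [nz|tr] := pselect (exists a : self_mod A, a <> 0); last first.
  have -> : ip x y = 0 :> A by apply: contrapT => h; apply: tr; exists (ip x y).
  by rewrite rnorm0 mulr_ge0 ?rnorm_ge0.
pose B := bounded_ops (@self_cauchy_schwarz R A) nz.
pose L (a : A) : B := lmul a.
have LD a b : L (a + b) = L a + L b.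
  by apply: adjop_ext => z; exact: cmulDl.
have LZ (k : R[i]) a : L (k *: a) = k *: L a.
  by apply: adjop_ext => z; rewrite /= -cscalerAl.
have LM a b : L (cmul a b) = L a * L b.
  by apply: adjop_ext => z; rewrite /= -cmulA.
have LS a : L (cstar a) = ustar (L a).
  by symmetry; apply: adj_unique; exact: lmul_adjoint.
have LB a b : L (a - b) = L a - L b by rewrite -scaleN1r LD LZ scaleN1r.
have nL a : unorm (L a) = rnorm a by exact: opnorm_lmul.
set a : A := ip y x; set p : A := ip x x; set q : A := ip y y.
have [y0|y0] := eqVneq (rnorm y) 0.
  by rewrite (rnorm_eq0 y0) ip0r !rnorm0 mulr0.
have yp : 0 < rnorm y by rewrite lt_def y0 rnorm_ge0.
pose mu := rnorm y ^+ 2; have mu0 : 0 < mu by rewrite exprn_gt0.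
have sq : cstar q = q by exact: ip_star.
have sp : cstar p = p by exact: ip_star.
pose z := x - (mu^-1)%:C *: ract y a.
have zz : ip z z = p - (mu^-1)%:C *: cmul (cstar a) a -
    ((mu^-1)%:C *: cmul (cstar a) a -
     (mu^-1)%:C *: ((mu^-1)%:C *: cmul (cmul (cstar a) q) a)) :> A.
  rewrite /z ipBl !ipBr !ipZl !ipZr !ip_ract !ip_ractl -/a -/p -/q.
  by rewrite conj_Creal ?complex_real// -[ip x y]ip_star.
have [b bz] := ip_ge0 z.
have pz : upos (L (ip z z)) by rewrite bz LM LS; exact: upos_starM.
have pa : upos (ustar (L a) * L a) by exact: upos_starM.
have nq : rnorm q = mu by rewrite /mu rnorm_ip.
have sLq : ustar (L q) = L q by rewrite -LS sq.
have pq : upos (mu%:C *: 1 - L q) by apply: norm_le_upos => //; rewrite nL nq.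
have pd : upos (mu%:C *: L p - ustar (L a) * L a).
  (* The correction term mu^-1 a^⋆ (mu - q) a accounts for q = <y, y> being dominated by mu = |y|^2
     rather than equal to it. *)
  have -> : mu%:C *: L p - ustar (L a) * L a = mu%:C *: L (ip z z) +
      (mu^-1)%:C *: (ustar (L a) * (mu%:C *: 1 - L q) * L a).
    have muK : mu%:C * (mu^-1)%:C = 1 by rewrite -rmorphM mulfV ?gt_eqF// rmorph1.
    rewrite zz !LB !LZ !LM LS !scalerBr !(scalerA mu%:C) muK !scale1r.
    rewrite mulrBr mulrBl -scalerAr mulr1 -scalerAl scalerBr.
    by rewrite (scalerA _ mu%:C) [(mu^-1)%:C * _]mulrC muK scale1r; ncring.
  apply: uposD; apply: uposZ => //; rewrite ?invr_ge0 ?ltW//.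
  exact: upos_conj.
have pm : upos ((mu * rnorm p)%:C *: 1 - ustar (L a) * L a).
  have -> : (mu * rnorm p)%:C *: 1 - ustar (L a) * L a =
      mu%:C *: ((rnorm p)%:C *: 1 - L p) + (mu%:C *: L p - ustar (L a) * L a).
    by rewrite scalerBr scalerA -rmorphM; ncring.
  apply: uposD => //; apply: uposZ; first exact: ltW.
  by apply: norm_le_upos; rewrite ?nL// -LS sp.
have mp : 0 <= mu * rnorm p by rewrite mulr_ge0 ?rnorm_ge0 ?ltW.
have := upos_norm_le mp pa pm; rewrite unorm_starM nL.
rewrite -[ip x y]ip_star -/a rnorm_cstar /mu -rnorm_ip -exprMn => h.
by rewrite mulrC -(ler_pXn2r (n := 2)) ?nnegrE ?mulr_ge0 ?rnorm_ge0.
Qed.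

End CauchySchwarz.

(** * The matched projection *)

Section MatchedProjection.
Variables (R : realType) (A : cstarAlgType R) (H : hilbertModType A).

(** The ingredients of [matched_proj] are picked by [xget] with default 0; each is identified by a
    witness and its uniqueness. *)
Lemma xget_eq (T : choiceType) (x0 : T) (P : set T) (x : T) :
  P x -> (forall y, P y -> y = x) -> xget x0 P = x.
Proof. by move=> Px h; apply: h; case: xgetP => // /(_ x). Qed.

Lemma opcompA (E1 E2 E3 E4 : hermModType A) (S : 'L(E3, E4)) (T : 'L(E2, E3))
  (U : 'L(E1, E2)) : S ∘ (T ∘ U) = S ∘ T ∘ U.
Proof. exact: adjop_ext. Qed.

Lemma opcomp1l (E F : hermModType A) (T : 'L(E, F)) : opid F ∘ T = T.
Proof. exact: adjop_ext. Qed.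

Lemma opcomp1r (E F : hermModType A) (T : 'L(E, F)) : T ∘ opid E = T.
Proof. exact: adjop_ext. Qed.

Lemma opinv_eq (E : hermModType A) (S T : 'L(E)) :
  S ∘ T = opid E -> T ∘ S = opid E -> opinv T = S.
Proof.
move=> ST TS; apply: xget_eq => // S' [S'T TS'].
by rewrite -[S']opcomp1r -TS opcompA S'T opcomp1l.
Qed.

(** The inclusion of V and the corestriction of P are mutually adjoint, because P fixes V and is
    selfadjoint. They transport operators between V and H. *)
Lemma complemented_incl (V : submodule H) (P : 'L(H)) :
  is_projection P -> range P = submod_set V ->
  exists (e : 'L(V, H)) (r : 'L(H, V)),
  [/\ forall v, e v = val v, forall x, val (r x) = P x, adj e = r & adj r = e] /\
  [/\ r ∘ e = opid V & e ∘ r = P].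
Proof.
move=> [PP sP] rP.
have PV x : P x \in submod_pred V by apply/mem_set; rewrite -rP; exists x.
have Pid (v : V) : P (val v) = val v.
  have /set_mem := valP v; rewrite -rP => -[z _ <-].
  by rewrite -[P (P z)]/((P ∘ P) z) PP.
pose cor x : V := SubmodElt (PV x).
have adjV : @is_adjoint R A V H val cor.
  by move=> v x; rewrite -[in LHS]Pid adjP sP.
pose e := mkadj adjV; pose r := mkadj (is_adjoint_sym adjV).
exists e, r; split; split => //.
- exact: adj_unique.
- by apply: adj_unique; exact: is_adjoint_sym.
- by apply: adjop_ext => v; apply: val_inj; exact: Pid.
- exact: adjop_ext.
Qed.

Lemma proj_onto_eq (V : submodule H) (P : 'L(H)) :
  is_projection P -> range P = submod_set V -> proj_onto V = P.
Proof.
move=> [PP sP] rP; apply: xget_eq => // P' [[PP' sP'] rP'].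
have absorb (S T : 'L(H)) : S ∘ S = S -> range S = range T -> S ∘ T = T.
  move=> SS ST; apply: adjop_ext => x.
  have [z _ zx] : range S (T x) by rewrite ST; exists x.
  by rewrite opcompE -zx -[S (S z)]/((S ∘ S) z) SS.
have PP'1 : P' ∘ P = P by apply: absorb; rewrite ?rP.
have PP'2 : P ∘ P' = P' by apply: absorb; rewrite ?rP.
by rewrite -PP'2 -sP -{1}sP' -adj_comp PP'1.
Qed.

(** * Block operators along an orthogonal decomposition *)

Section Blocks.
Variables (V W : submodule H) (P : 'L(H)).
Variables (e : 'L(V, H)) (r : 'L(H, V)) (e' : 'L(W, H)) (r' : 'L(H, W)).
Hypotheses (eE : forall v, e v = val v) (rE : forall x, val (r x) = P x).
Hypotheses (ae : adj e = r) (ar : adj r = e) (re : r ∘ e = opid V).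
Hypotheses (eE' : forall v, e' v = val v).
Hypotheses (rE' : forall x, val (r' x) = (opid H - P) x).
Hypotheses (ae' : adj e' = r') (ar' : adj r' = e').

Lemma op_restr_eq (T : 'L(H)) : P ∘ T ∘ e' = T ∘ e' ->
  op_restr W V T = r ∘ T ∘ e'.
Proof.
move=> h; apply: xget_eq => [x|S hS].
  by rewrite /= rE -[P _]/((P ∘ T ∘ e') x) h /= eE'.
apply: adjop_ext => x; apply: val_inj.
by rewrite hS /= rE -[P _]/((P ∘ T ∘ e') x) h /= eE'.
Qed.

(** U is the pair (r, r'), so its adjoint is the sum of the two inclusions. *)
Lemma split_block (a : 'L(V)) (b : 'L(W, V)) (c : 'L(V, W)) (d : 'L(W))
    (k : R[i]) (U := op_split V W P) :
  U^† ∘ (k *: opblock a b c d) ∘ U =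
  k *: (e ∘ a ∘ r + e ∘ b ∘ r' + e' ∘ c ∘ r + e' ∘ d ∘ r').
Proof.
have adjU : @is_adjoint R A H (V * W)%type (fun h => (r h, r' h))
    (fun u => e u.1 + e' u.2).
  by move=> h [v w]; rewrite ipDr -ar -ar' -!adjP.
have UE : U = mkadj adjU.
  apply: xget_eq => [h|S hS]; first by rewrite /= rE rE'.
  apply: adjop_ext => h; have [h1 h2] := hS h.
  rewrite /=; case: (S h) h1 h2 => v w /= h1 h2.
  by congr (_, _); apply: val_inj; rewrite ?rE ?rE'.
have aU u : adj U u = e u.1 + e' u.2.
  rewrite UE; have -> // : adj (mkadj adjU) = mkadj (is_adjoint_sym adjU).
  by apply: adj_unique; exact: adjU.
apply: adjop_ext => h; rewrite !opcompE aU UE /=.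
by rewrite !adjopZ -scalerDr !adjopD addrA.
Qed.

Section Sqrt.
Variable nz : exists x : H, x <> 0.
Let B := bounded_ops (@cauchy_schwarz_hilbert R A H) nz.

(** V carries only an inner product structure, so uniqueness of positive roots is borrowed from
    ['L(H)] through the injective star homomorphism sending X to e X r. *)
Lemma opsqrt_eq (T S : 'L(V)) : oppositive S -> S ∘ S = T -> opsqrt T = S.
Proof.
have lift (X Y : 'L(V)) : e ∘ (X ∘ Y) ∘ r = (e ∘ X ∘ r) ∘ (e ∘ Y ∘ r).
  by rewrite !opcompA -(opcompA _ r e) re opcomp1r.
have lift_pos (X : 'L(V)) : oppositive X -> upos (e ∘ X ∘ r : B).
  move=> [Y ->]; rewrite lift.
  have -> : e ∘ adj Y ∘ r = adj (e ∘ Y ∘ r) by rewrite !adj_comp ae ar opcompA.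
  exact: (upos_starM (e ∘ Y ∘ r : B)).
move=> pS SS; apply: xget_eq => // X [pX XX].
have h : (e ∘ X ∘ r : B) = (e ∘ S ∘ r : B).
  apply: upos_sqrt_uniq; [exact: lift_pos|exact: lift_pos|].
  by rewrite -[LHS]lift -[RHS]lift XX SS.
have unlift (Y : 'L(V)) : r ∘ (e ∘ Y ∘ r) ∘ e = Y.
  by rewrite !opcompA re opcomp1l -opcompA re opcomp1r.
by rewrite -[X]unlift [e ∘ X ∘ r]h unlift.
Qed.

End Sqrt.
End Blocks.

Section Main.
Variables (Q : 'L(H)) (nz : exists x : H, x <> 0).
Hypothesis QQ : is_idempotent Q.
Let B := bounded_ops (@cauchy_schwarz_hilbert R A H) nz.

Lemma matched_projE (p b c d : B) (n := (Q : B) - p) :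
  p * p = p -> ustar p = p -> p * (Q : B) = Q -> (Q : B) * p = p ->
  upos b -> b * b = 1 + n * ustar n + ustar n * n -> GRing.comm b p ->
  c * b = 1 -> b * c = 1 -> d * (b + 1) = 1 -> (b + 1) * d = 1 ->
  ~ is_projection Q ->
  matched_proj Q = (matched_expr (Q : B) p b c d : 'L(H)).
Proof.
move=> pp sp pq qp pb bb cbp cb bc db bd nproj.
have projp : is_projection (p : 'L(H)) by split.
have rp : range (p : 'L(H)) = submod_set (op_range Q).
  apply/seteqP; split=> _ [x _ <-].
    by exists ((p : 'L(H)) x) => //; rewrite -opcompE [Q ∘ p]qp.
  by exists (Q x) => //; rewrite -opcompE [p ∘ Q]pq.
have projp' : is_projection (opid H - (p : 'L(H))).
  have h : (1 - p) * (1 - p) = 1 - p.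
    have -> : (1 - p) * (1 - p) = 1 - p - p + p * p by ncring.
    by rewrite pp; ncring.
  split; first exact: h.
  by have : ustar (1 - p) = 1 - p by rewrite ustarB ustar1 sp.
have Qp : p * ustar (Q : B) = p by rewrite -{1}sp -ustarM qp sp.
have Qp' : ustar (Q : B) * p = ustar (Q : B) by rewrite -{1}sp -ustarM pq.
have rp' : range (opid H - (p : 'L(H))) = submod_set (op_ker Q^†).
  apply/seteqP; split=> [_ [x _ <-]|x /= x0].
    rewrite /= -[LHS]/((ustar (Q : B) * (1 - p) : 'L(H)) x) mulrBr Qp' mulr1 subrr.
    by [].
  exists x => //=.
  have px : (p : 'L(H)) x = 0.
    by rewrite -{1}Qp -[LHS]/((p : 'L(H)) (Q^† x)) x0 adjop0.
  by rewrite -[LHS]/(x - (p : 'L(H)) x) px subr0.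
have [e [r [[eE rE ae ar] [re er]]]] := complemented_incl projp rp.
have [e' [r' [[eE' rE' ae' ar'] [re' er']]]] := complemented_incl projp' rp'.
rewrite /matched_proj asboolF// (proj_onto_eq projp rp).
rewrite (split_block rE ar rE' ar').
have np : n * p = 0 by rewrite mulrBl qp pp subrr.
have pn : p * n = n by rewrite mulrBr pq pp.
have pe : (p : 'L(H)) ∘ e = e by rewrite -er -opcompA re opcomp1r.
rewrite (op_restr_eq rE eE'); last by rewrite [p ∘ _]pn.
set T := r ∘ _ ∘ e'.
have aT : adj T = r' ∘ (ustar n : B) ∘ e.
  by rewrite /T !adj_comp ar ae' opcompA.
(* Compression to the range of Q is multiplicative when the right factor commutes with p; it turns
   b, c, c d into B, B^-1, [B (B + I)]^-1. *)
pose res (X : B) : 'L(op_range Q) := r ∘ (X : 'L(H)) ∘ e.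
have resM (X Y : B) : Y * p = p * Y -> res X ∘ res Y = res (X * Y).
  move=> h; rewrite /res !opcompA -(opcompA _ e r) er.
  rewrite -(opcompA (r ∘ _) (p : 'L(H))) -[p ∘ Y]h !opcompA.
  by rewrite -(opcompA _ (p : 'L(H))) pe.
have res1 : res 1 = opid _ by rewrite /res opcomp1r re.
have resD (X Y : B) : res X + res Y = res (X + Y).
  by apply: adjop_ext => v; rewrite /= adjopD.
have cinv (x : B) : GRing.comm b x -> GRing.comm c x.
  by move=> h; apply/commr_sym/(comm_inv cb bc)/commr_sym.
have b1c (x : B) : GRing.comm b x -> GRing.comm (b + 1) x.
  by move=> h; apply/commr_sym/commrD; [exact: commr_sym | exact: commr1].
have dinv (x : B) : GRing.comm b x -> GRing.comm d x.
  by move=> h; apply/commr_sym/(comm_inv db bd)/commr_sym/b1c.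
have n1p : n * (1 - p) = n by rewrite mulrBr mulr1 np subr0.
have n'p : ustar n * p = ustar n by rewrite -{1}sp -ustarM pn.
have pn' : p * ustar n = 0 by rewrite -{1}sp -ustarM np ustar0.
have n1p' : (1 - p) * ustar n = ustar n by rewrite mulrBl mul1r pn' subr0.
(* The summand n^⋆ n of b^2 disappears in the compression because n p = 0. *)
have TT : T ∘ adj T + opid (op_range Q) = res b ∘ res b.
  rewrite resM// aT /T !opcompA -(opcompA _ e' r') er'.
  rewrite -(opcompA r (n : 'L(H))) [n ∘ _]n1p -res1 -(opcompA r (n : 'L(H))) resD.
  have n0 : res (ustar n * n) = 0.
    have h : ustar n * n * p = 0 by rewrite -mulrA np mulr0.
    transitivity (r ∘ (ustar n * n * p : B) ∘ e).
      by rewrite /res -{1}pe opcompA -(opcompA r).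
    by apply: adjop_ext => v; rewrite h /= adjop0.
  by rewrite bb -[RHS]resD n0 addr0 addrC.
have pb' : oppositive (res b).
  have [s [ps ss sc]] := upos_sqrt pb.
  have csp : GRing.comm s p by apply/commr_sym/sc/commr_sym.
  have -> : res b = adj (res s) ∘ res s.
    rewrite {1}/res !adj_comp ar ae -/(ustar s) (upos_sa ps) opcompA.
    by rewrite [RHS]resM// ss.
  by exists (res s).
rewrite TT (opsqrt_eq ae ar re nz pb' erefl).
have -> : res b + opid (op_range Q) = res (b + 1) by rewrite -res1 resD.
have cp : GRing.comm c p by exact: cinv.
have dp : GRing.comm d p by exact: dinv.
have bp1 : GRing.comm (b + 1) p by exact: b1c.
have dc : GRing.comm d c by apply/dinv/commr_sym/cinv; exact: commr_refl.
have db' : GRing.comm d b by apply/dinv; exact: commr_refl.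
have cb1 : GRing.comm c (b + 1) by apply/cinv/commr_sym/b1c; exact: commr_refl.
have cdp : GRing.comm p (c * d) by apply: commrM; exact: commr_sym.
have -> : opinv (res b) = res c by apply: opinv_eq; rewrite resM// ?cb ?bc.
have -> : opinv (res b ∘ res (b + 1)) = res (c * d).
  rewrite resM//; apply: opinv_eq; rewrite resM//.
  - by rewrite -mulrA (mulrA d) db' -mulrA (mulrA c) cb mul1r db.
  - by apply/commr_sym/commrM; exact: commr_sym.
  - by rewrite -mulrA (mulrA _ c) -cb1 -mulrA bd mulr1 bc.
have sand (X : B) : e ∘ res X ∘ r = p * X * p.
  by rewrite /res !opcompA er -opcompA er.
have E1 : e ∘ (res (b + 1) ∘ res c) ∘ r = (b + 1) * c * p.
  rewrite resM// sand.
  have cpb : GRing.comm p ((b + 1) * c) by apply: commrM; exact: commr_sym.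
  by rewrite cpb -mulrA pp.
have E2 : e ∘ (res c ∘ T) ∘ r' = c * n.
  transitivity (p * c * p * n * (1 - p)).
    by rewrite /res /T !opcompA er -(opcompA _ e r) er -(opcompA _ e' r') er'.
  by rewrite -!mulrA n1p pn mulrA -cp -mulrA pn.
have E3 : e' ∘ (adj T ∘ res c) ∘ r = ustar n * c.
  transitivity ((1 - p) * ustar n * p * c * p).
    by rewrite aT /res !opcompA er' -!(opcompA _ e r) er.
  by rewrite n1p' n'p -mulrA cp mulrA n'p.
have E4 : e' ∘ (adj T ∘ res (c * d) ∘ T) ∘ r' = ustar n * (c * d) * n.
  have -> (X : B) : e' ∘ (adj T ∘ res X ∘ T) ∘ r' =
      (1 - p) * ustar n * p * X * p * n * (1 - p).
    by rewrite aT /res /T !opcompA er' -!(opcompA _ e r) er -(opcompA _ e' r') er'.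
  by rewrite n1p' n'p -(mulrA _ n) n1p -(mulrA _ p n) pn.
rewrite E1 E2 E3 E4 /matched_expr; congr (_ *: _).
by rewrite fmorphV rmorph_nat.
Qed.

End Main.
End MatchedProjection.

Theorem theorem4p17 (R : realType) (A : cstarAlgType R) (H : hilbertModType A)
    (Q : 'L(H)) (Qidem : is_idempotent Q) (Qneq0 : Q <> 0) :
  opnorm (matched_proj Q - Q) =
    2^-1 * (opnorm Q - 1 + Num.sqrt (opnorm Q ^+ 2 - 1)).
Proof.
have nz : exists x : H, x <> 0.
  apply: contrapT => h; apply: Qneq0; apply: adjop_ext => x.
  by apply: contrapT => Qx; apply: h; exists (Q x).
pose B := bounded_ops (@cauchy_schwarz_hilbert R A H) nz.
have q0 : (Q : B) != 0 by apply/eqP.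
(* For a projection m(Q) = Q, and |Q|^2 = |Q| with Q nonzero gives |Q| = 1, so both sides vanish. *)
have [projQ|nproj] := pselect (is_projection Q).
  rewrite /matched_proj asboolT// subrr.
  have -> : opnorm (0 : 'L(H)) = 0 by exact: (unorm0 B).
  have -> : opnorm Q = 1.
    have := unorm_sq (projQ.2 : ustar (Q : B) = Q).
    rewrite (Qidem : (Q : B) * Q = Q) => h.
    apply: (mulfI (lt0r_neq0 (unorm_neq0 q0))).
    by rewrite mulr1 [LHS](_ : _ = unorm (Q : B) ^+ 2) -?h// expr2.
  by rewrite expr1n !subrr sqrtr0 addr0 mulr0.
have [p [b [c [d [[pp sp pq qp] [pb bb cbq cbp] [cb bc] [db bd]]]]]] :=
  idempotent_split (Qidem : (Q : B) * Q = Q).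
have bb' := matched_sq pp sp pq qp bb.
rewrite (matched_projE pp sp pq qp pb bb' cbp cb bc db bd nproj).
exact: (matched_theorem pp sp pq qp pb bb cbq cbp cb bc db bd q0).
Qed.
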